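(* Let $X$ be a condensed concrete ergodic fibrant cubeset. Then there exists a tower of surjective fibrations (of condensed cubesets) $$X\to\cdots\to\tau_2X\to\tau_1X\to\tau_0X$$ such that each $\tau_nX$ ($n\ge0$) is a condensed concrete fibrant $n$-step cubeset and, for $n\ge1$ (and a base point $x_0$ of $X$), $\tau_nX$ is a principal $\mathcal D_n(\pi_n(X,x_0))$-bundle over $\tau_{n-1}X$. This tower is natural in $X$.
   Context: Cubesets. The cube category $\Box$ has objects $\{0,1\}^n$ ($n\in\mathbb N_0$); morphisms are the maps $\{0,1\}^n\to\{0,1\}^m$ that are restrictions of affine linear maps $\mathbb Z^n\to\mathbb Z^m$. A cubeset is a presheaf of sets $X$ on $\Box$; $X(n)$ is its value on $\{0,1\}^n$, $\Box^n$ the presheaf represented by $\{0,1\}^n$. For $1\le i\le n$, $\varepsilon_i\colon\{0,1\}^{n-1}\to\{0,1\}^n$ inserts a $0$ at coordinate $i$; the corner $\Lambda^n\subseteq\Box^n$ ($n\ge1$) is the union of the images of the $\varepsilon_i$. A cubeset is $n$-step ($n\ge 0$) if $\mathrm{Hom}(\Box^k,X)\to\mathrm{Hom}(\Lambda^k,X)$ is bijective for all $k>n$, and $\tau_n$ is the left adjoint of the inclusion of $n$-step cubesets into cubesets (it preserves finite products). For an $n$-step cubeset $Y$, $n\ge1$, $y_0\in Y(0)$, $\pi_n(Y,y_0)$ is the set of $c\in Y(n)$ whose restriction to $\Lambda^n$ is constant $y_0$, with $a*b=d\circ s$ where $d\in Y(n+1)$ is the unique cube with $d\circ\varepsilon_1=a$,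 $d\circ\varepsilon_2=b$, $d\circ\varepsilon_i$ constant $y_0$ for $3\le i\le n+1$, and $s(x_1,\dots,x_n)=(x_1,x_1,x_2,\dots,x_n)$. For a general cubeset, $\pi_n(X,x_0):=\pi_n(\tau_nX,x_0)$. For an abelian group $A$ and $k\ge1$, $\mathcal D_k(A)$ is the cubeset whose $n$-cubes are the subgroup of $A^{\{0,1\}^n}$ generated by the functions equal to $a\in A$ on $F$ and $0$ off $F$, for $F$ a face of $\{0,1\}^n$ (fixing some coordinates) of dimension at least $n-k$. Condensed objects. Fix an uncountable strong limit cardinal $\kappa$; let $\mathrm{Extr}_\kappa$ be the category of extremally disconnected compact Hausdorff spaces of weight $<\kappa$. A condensed set is a functor $\mathrm{Extr}_\kappa^{op}\to\mathrm{Set}$ preserving finite products. A condensed cubeset is a functor $\Box^{op}\to\mathrm{CondSet}$, equivalently a finite-product-preserving functor $\mathrm{Extr}_\kappa^{op}\to\mathrm{cSet}$, $E\mapsto X(E)$. Injections and surjections of condensed sets are mono-/epimorphisms (equivalently injective/surjective on $E$-points for all $E\in\mathrm{Extr}_\kappa$). For a condensed cubeset $X$ let $\mathrm{Hom}(\Lambda^n,X)$ be the condensed set $E\mapsto\mathrm{Hom}(\Lambda^n,X(E))$, and $X(n)$ the condensed set of $n$-cubes. $X$ is concrete if $X(n)\to X(0)^{2^n}$ is injective for all $n$; a map $X\to Y$ is a fibration if $X(n)\to\mathrm{Hom}(\Lambda^n,X)\times_{\mathrm{Hom}(\Lambda^n,Y)}Y(n)$ is surjective for all $n\ge1$; $X$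 is fibrant if $X\to*$ is a fibration; $X$ is $n$-step if $X(k)\to\mathrm{Hom}(\Lambda^k,X)$ is an isomorphism for all $k>n$. $\tau_n$ is the left adjoint of the inclusion of $n$-step condensed cubesets; it is computed pointwise, $(\tau_nX)(E)=\tau_n(X(E))$. The maps of the tower are the units. $X$ is ergodic if $\tau_0X=*$. A base point is $x_0\in X( * )(0)$. Structure monoids and $\mathcal D_n$ are defined pointwise: $\pi_n(X,x_0)(E)=\pi_n(X(E),x_0)$ (a condensed abelian group for $X$ concrete fibrant) and $\mathcal D_n(A)(E)=\mathcal D_n(A(E))$ for a condensed abelian group $A$. Principal bundle (no local triviality required). For a group object $G$ in a category, a principal $G$-bundle over $B$ is a map $p\colon P\to B$ with a $G$-action $\alpha\colon G\times P\to P$ over $B$ such that $(\alpha,\mathrm{pr}_2)\colon G\times P\to P\times_BP$ is an isomorphism and $G\times P\rightrightarrows P\xrightarrow{p}B$ (the two maps being $\alpha$ and $\mathrm{pr}_2$) is a coequalizer. *)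

(* Defs.v *)
From HB Require Import structures.
From mathcomp Require Import all_boot all_order all_algebra.
From mathcomp Require Import zify.
From mathcomp Require Import all_classical.
From mathcomp Require Import topology.

Set Implicit Arguments.
Unset Strict Implicit.
Unset Printing Implicit Defensive.

Import GRing.Theory.

Local Open Scope classical_set_scope.
Local Open Scope ring_scope.

Notation cube n := {ffun 'I_n -> bool}.

Definition zvec n (x : cube n) : 'rV[int]_n := \row_i (nat_of_bool (x i))%:Z.

Definition affine m n (f : cube m -> cube n) : Prop :=
  exists (A : 'M[int]_(m, n)) (b : 'rV[int]_n),
    forall x, zvec (f x) = zvec x *m A + b.

Record boxHom (m n : nat) := BoxHom {
  box_fun :> cube m -> cube n;
  box_affine : affine box_fun }.

Lemma boxHom_ext m n (f g : boxHom m n) : f =1 g -> f = g.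
Proof.
case: f g => [f hf] [g hg] /= /funext fg; case: g / fg hg => hg.
by congr BoxHom; exact: Prop_irrelevance.
Qed.

Lemma affine_id n : affine (@id (cube n)).
Proof. by exists 1%:M, 0 => x; rewrite mulmx1 addr0. Qed.

Lemma affine_comp m n p (g : cube n -> cube p) (f : cube m -> cube n) :
  affine g -> affine f -> affine (g \o f).
Proof.
move=> [A [a hg]] [B [b hf]]; exists (B *m A), (b *m A + a) => x /=.
by rewrite hg hf mulmxDl mulmxA addrA.
Qed.

Lemma affine_select m n (f : cube m -> cube n) (s : 'I_n -> 'I_m + bool) :
  (forall x j, f x j = match s j with inl i => x i | inr b => b end) ->
  affine f.
Proof.
move=> fE; exists (\matrix_(i, j) (s j == inl i)%:Z),
  (\row_j (s j == inr true)%:Z) => x; apply/rowP => j; rewrite !mxE fE.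
under eq_bigr do rewrite !mxE.
case: (s j) => [i|b].
  rewrite (bigD1 i) //= eqxx mulr1 big1 ?addr0// => k ki.
  by rewrite (_ : (_ == _) = false) ?mulr0//; apply/eqP => -[] /esym/eqP; rewrite (negbTE ki).
by rewrite big1 ?add0r; [case: b|move=> k _; rewrite mulr0].
Qed.

Definition box_id n : boxHom n n := BoxHom (@affine_id n).

Definition box_comp m n p (g : boxHom n p) (f : boxHom m n) : boxHom m p :=
  BoxHom (affine_comp (box_affine g) (box_affine f)).

(* The map inserting a 0 at coordinate i; coordinates are numbered from 0 *)
Definition eps_fun n (i : 'I_n) (x : cube n.-1) : cube n :=
  [ffun j => if unlift i j is Some k then x k else false].

Lemma eps_affine n (i : 'I_n) : affine (eps_fun i).
Proof.
apply: (@affine_select _ _ _ (fun j =>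
  if unlift i j is Some k then inl k else inr false)) => x j.
by rewrite ffunE; case: (unlift i j).
Qed.

Definition eps n (i : 'I_n) : boxHom n.-1 n := BoxHom (@eps_affine n i).

Definition drop_fun n (i : 'I_n) (x : cube n) : cube n.-1 :=
  [ffun j => x (lift i j)].

Lemma drop_affine n (i : 'I_n) : affine (drop_fun i).
Proof.
by apply: (@affine_select _ _ _ (fun j => inl (lift i j))) => x j; rewrite ffunE.
Qed.

Definition box_drop n (i : 'I_n) : boxHom n n.-1 := BoxHom (@drop_affine n i).

Definition vertex_fun n (v : cube n) (x : cube 0) : cube n := v.

Lemma vertex_affine n (v : cube n) : affine (vertex_fun v).
Proof. by apply: (@affine_select _ _ _ (fun j => inr (v j))). Qed.

Definition vertex n (v : cube n) : boxHom 0 n := BoxHom (vertex_affine v).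

Definition box_term_fun n (x : cube n) : cube 0 := [ffun _ => false].

Lemma box_term_affine n : affine (@box_term_fun n).
Proof. by apply: (@affine_select _ _ _ (fun j => inr false)) => x []. Qed.

Definition box_term n : boxHom n 0 := BoxHom (@box_term_affine n).

(* (x_1, ..., x_n) |-> (x_1, x_1, x_2, ..., x_n), for n >= 1 *)
Definition dup_fun n (x : cube n.+1) : cube n.+2 :=
  [ffun j => if unlift ord0 j is Some k then x k else x ord0].

Lemma dup_affine n : affine (@dup_fun n).
Proof.
apply: (@affine_select _ _ _ (fun j =>
  inl (if unlift ord0 j is Some k then k else ord0))) => x j.
by rewrite ffunE; case: (unlift ord0 j).
Qed.

Definition dup n : boxHom n.+1 n.+2 := BoxHom (@dup_affine n).

Lemma box_term_uniq n (f g : boxHom n 0) : f = g.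
Proof. by apply: boxHom_ext => x; apply/ffunP => -[]. Qed.

Lemma eps_drop m n (i : 'I_n) (f : boxHom m n) :
  (forall x, f x i = false) -> f = box_comp (eps i) (box_comp (box_drop i) f).
Proof.
move=> fi; apply: boxHom_ext => x; apply/ffunP => j; rewrite /= ffunE.
by case: unliftP => [k ->|->]; rewrite ?ffunE ?fi.
Qed.

Lemma eps_at n (i : 'I_n) x : eps i x i = false.
Proof. by rewrite ffunE unlift_none. Qed.

Record cubeset := Cubeset {
  cubes :> nat -> Type;
  pull : forall m n, boxHom m n -> cubes n -> cubes m;
  pull_id : forall n (c : cubes n), pull (box_id n) c = c;
  pull_comp : forall m n p (g : boxHom n p) (f : boxHom m n) (c : cubes p),
    pull (box_comp g f) c = pull f (pull g c) }.
Arguments pull {c m n} f _ : rename.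

Record cmap (X Y : cubeset) := Cmap {
  cmap_fun :> forall n, X n -> Y n;
  cmap_pull : forall m n (f : boxHom m n) (c : X n),
    cmap_fun (pull f c) = pull f (cmap_fun c) }.
Arguments cmap_fun {X Y} _ {n} _.

Lemma cmap_ext X Y (f g : cmap X Y) : (forall n (c : X n), f n c = g n c) -> f = g.
Proof.
case: f g => [f hf] [g hg] /= fg.
have {}fg : f = g by apply: functional_extensionality_dep => n; apply: funext => c.
by case: g / fg hg => hg; congr Cmap; exact: Prop_irrelevance.
Qed.

Definition cmap_id X : cmap X X := @Cmap X X (fun _ c => c) (fun _ _ _ _ => erefl).

Lemma cmap_comp_pull X Y Z (g : cmap Y Z) (f : cmap X Y) m n (h : boxHom m n) (c : X n) :
  g m (f m (pull h c)) = pull h (g n (f n c)).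
Proof. by rewrite !cmap_pull. Qed.

Definition cmap_comp X Y Z (g : cmap Y Z) (f : cmap X Y) : cmap X Z :=
  Cmap (cmap_comp_pull g f).

Definition in_corner n m (f : boxHom m n) : Prop :=
  exists (i : 'I_n) (g : boxHom m n.-1), f = box_comp (eps i) g.

Lemma sig_ext T (P : T -> Prop) (x y : {x | P x}) : sval x = sval y -> x = y.
Proof. by case: x y => [x hx] [y hy] /= xy; exact: eq_exist. Qed.

Lemma in_corner_comp n m p (f : boxHom m n) (g : boxHom p m) :
  in_corner f -> in_corner (box_comp f g).
Proof. by move=> [i [h ->]]; exists i, (box_comp h g); exact: boxHom_ext. Qed.

(* The corner, a subpresheaf of the representable presheaf boxHom ^~ n *)
Program Definition corner (n : nat) : cubeset :=
  @Cubeset (fun m => {f : boxHom m n | in_corner f})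
    (fun p m g f => exist _ (box_comp (sval f) g) (in_corner_comp g (svalP f))) _ _.
Next Obligation. by move=> n m f; apply: sig_ext; exact: boxHom_ext. Qed.
Next Obligation. by move=> n p m q g f c; apply: sig_ext; exact: boxHom_ext. Qed.

Program Definition corner_restr (X : cubeset) n (c : X n) : cmap (corner n) X :=
  @Cmap (corner n) X (fun m f => pull (sval f) c) _.
Next Obligation. by move=> X n c m p f g /=; rewrite pull_comp. Qed.

(* Cubes c in X(k) stand for the maps from the representable cubeset to X, by
   the Yoneda lemma. *)
Definition n_step (n : nat) (X : cubeset) : Prop :=
  forall k, (n < k)%N -> bijective (@corner_restr X k).

Lemma n_step_inj n X : n_step n X -> forall k (c d : X k), (n < k)%N ->
  (forall m (f : corner k m), pull (sval f) c = pull (sval f) d) -> c = d.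
Proof.
move=> nX k c d nk cd; apply: (bij_inj (nX k nk)).
by apply: cmap_ext => m f; exact: cd.
Qed.

Lemma n_step_fill n X : n_step n X -> forall k (h : cmap (corner k) X), (n < k)%N ->
  exists c : X k, forall m (f : corner k m), pull (sval f) c = h m f.
Proof.
move=> nX k h nk; have [g _ gK] := nX k nk; exists (g h) => m f.
by have /(congr1 (fun u : cmap _ _ => u m f)) := gK h.
Qed.

Lemma n_stepP n (X : cubeset) :
  (forall k (c d : X k), (n < k)%N ->
    (forall m (f : corner k m), pull (sval f) c = pull (sval f) d) -> c = d) ->
  (forall k (h : cmap (corner k) X), (n < k)%N ->
    exists c : X k, forall m (f : corner k m), pull (sval f) c = h m f) ->
  n_step n X.
Proof.
move=> inj fill k nk; exists (fun h => sval (cid (fill k h nk))) => [c|h] /=.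
  by case: cid => d /= hd; apply: inj nk _ => m f; rewrite hd.
by case: cid => d /= hd; apply: cmap_ext => m f; rewrite -hd.
Qed.

(* The left adjoint tau_n. Cubes of [tau_cubeset n X] are formal terms built from
   cubes of X by restriction and by filling of corners of dimension > n. A term
   need not have a value in an n-step cubeset under X, since the family in
   [TFill] need not form a corner there; it is valid if it has a value in all of
   them, and two terms are identified if their values always agree. The universal
   property is [tau_n_step], [tau_desc_unit] and [tau_uniq]. *)

Section Tau.
Variables (n : nat) (X : cubeset).

Inductive tau_term : nat -> Type :=
| TIn k : X k -> tau_term k
| TPull k m : boxHom m k -> tau_term k -> tau_term m
| TFill k : (n < k)%N -> (forall m, corner k m -> tau_term m) -> tau_term k.

Fixpoint tau_eval (Y : cubeset) (f : cmap X Y) k (t : tau_term k) : set (Y k) :=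
  match t in tau_term k return set (Y k) with
  | TIn k c => [set f k c]
  | TPull k m g t => pull g @` tau_eval f t
  | TFill k _ h => [set y | forall m (g : corner k m),
                      tau_eval f (h m g) (pull (sval g) y)]
  end.

Definition tau_valid k (t : tau_term k) : Prop :=
  forall Y (f : cmap X Y), n_step n Y -> tau_eval f t !=set0.

Definition tau_rel k (t : tau_term k) : set (tau_term k) :=
  [set t' | forall Y (f : cmap X Y), n_step n Y -> tau_eval f t = tau_eval f t'].

Definition tau_cubes k : Type :=
  {S : set (tau_term k) | exists2 t, tau_valid t & S = tau_rel t}.

Definition tau_class k (t : tau_term k) (v : tau_valid t) : tau_cubes k :=
  exist _ (tau_rel t) (ex_intro2 _ _ t v erefl).

Definition tau_repr k (c : tau_cubes k) : tau_term k := s2val (cid2 (svalP c)).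

Lemma tau_repr_valid k (c : tau_cubes k) : tau_valid (tau_repr c).
Proof. exact: (s2valP (cid2 (svalP c))). Qed.

Lemma tau_class_eq k (t t' : tau_term k) v v' :
  tau_rel t t' -> tau_class (t := t) v = tau_class (t := t') v'.
Proof.
move=> tt'; apply: sig_ext; apply/seteqP; split => s /= ts Y f nY.
  by rewrite -tt'// ts.
by rewrite tt'// ts.
Qed.

Lemma tau_reprK k (c : tau_cubes k) : tau_class (@tau_repr_valid k c) = c.
Proof. by apply: sig_ext => /=; exact/esym/(s2valP' (cid2 (svalP c))). Qed.

Lemma tau_repr_class k (t : tau_term k) (v : tau_valid t) :
  tau_rel (tau_repr (tau_class v)) t.
Proof.
by have /(congr1 sval) /= -> := tau_reprK (tau_class v).
Qed.

Lemma tau_eval_uniq Y (f : cmap X Y) : n_step n Y ->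
  forall k (t : tau_term k), is_subset1 (tau_eval f t).
Proof.
move=> nY k t; elim: t => {k} [k c|k m g t IH|k nk h IH] y y' /=.
- by move=> -> ->.
- by move=> [z tz <-] [z' tz' <-]; rewrite (IH z z').
- by move=> hy hy'; apply: (n_step_inj nY nk) => m g; exact: (IH m g).
Qed.

Lemma TPull_valid k m (g : boxHom m k) (t : tau_term k) :
  tau_valid t -> tau_valid (TPull g t).
Proof. by move=> vt Y f nY; have [y ty] := vt Y f nY; exists (pull g y), y. Qed.

Lemma TIn_valid k (c : X k) : tau_valid (TIn c).
Proof. by move=> Y f _; exists (f k c). Qed.

Definition tau_pull m k (g : boxHom m k) (c : tau_cubes k) : tau_cubes m :=
  tau_class (TPull_valid g (@tau_repr_valid k c)).

Lemma tau_pull_class m k (g : boxHom m k) (t : tau_term k) (v : tau_valid t) :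
  tau_pull g (tau_class v) = tau_class (TPull_valid g v).
Proof.
by apply: tau_class_eq => Y f nY /=; rewrite (tau_repr_class v f nY).
Qed.

Program Definition tau_cubeset : cubeset := @Cubeset tau_cubes tau_pull _ _.
Next Obligation.
move=> k c; rewrite -[c in RHS]tau_reprK; apply: tau_class_eq => Y f nY /=.
by apply/seteqP; split=> y /=; [move=> [z zt <-]|exists y]; rewrite ?pull_id.
Qed.
Next Obligation.
move=> m k p g f c; rewrite -[c]tau_reprK !tau_pull_class.
apply: tau_class_eq => Y u nY /=; apply/seteqP; split => y /=.
  by move=> [z zt <-]; rewrite pull_comp; exists (pull g z) => //; exists z.
by move=> [_ [z zt <-] <-]; exists z; rewrite ?pull_comp.
Qed.

Program Definition tau_cunit : cmap X tau_cubeset :=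
  @Cmap X tau_cubeset (fun k c => tau_class (@TIn_valid k c)) _.
Next Obligation.
move=> m k g c /=; rewrite tau_pull_class; apply: tau_class_eq => Y f nY /=.
apply/seteqP; split=> y /=.
  by move=> ->; exists (f k c); rewrite ?cmap_pull.
by move=> [_ -> <-]; rewrite cmap_pull.
Qed.

Section Desc.
Variables (Y : cubeset) (nY : n_step n Y) (f : cmap X Y).

Definition tau_desc_fun k (c : tau_cubeset k) : Y k :=
  sval (cid (@tau_repr_valid k c Y f nY)).

Lemma tau_desc_eval k (t : tau_term k) (v : tau_valid t) :
  tau_eval f t (tau_desc_fun (tau_class v)).
Proof.
rewrite -(tau_repr_class v f nY) /tau_desc_fun; exact: svalP.
Qed.

Program Definition tau_desc : cmap tau_cubeset Y :=
  @Cmap tau_cubeset Y tau_desc_fun _.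
Next Obligation.
move=> m k g c; rewrite -[c]tau_reprK /= tau_pull_class.
apply: (tau_eval_uniq nY (f := f) (t := TPull g (tau_repr c))).
  exact: tau_desc_eval.
by eexists => //; exact: tau_desc_eval.
Qed.

Lemma tau_desc_unit : cmap_comp tau_desc tau_cunit = f.
Proof. by apply: cmap_ext => k c /=; exact: (tau_desc_eval (@TIn_valid k c)). Qed.

End Desc.

Lemma tau_sep k (c d : tau_cubeset k) :
  (forall Y (nY : n_step n Y) (f : cmap X Y), tau_desc nY f k c = tau_desc nY f k d) ->
  c = d.
Proof.
rewrite -[c]tau_reprK -[d]tau_reprK => cd; apply: tau_class_eq => Y f nY.
have ev := cd Y nY f.
have e1 := tau_desc_eval nY f (@tau_repr_valid k c).
have e2 := tau_desc_eval nY f (@tau_repr_valid k d).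
rewrite /= in ev; rewrite -ev in e2.
apply/seteqP; split=> y yt.
  by rewrite (tau_eval_uniq nY yt e1).
by rewrite (tau_eval_uniq nY yt e2).
Qed.

Lemma tau_n_step : n_step n tau_cubeset.
Proof.
apply: n_stepP => k => [c d nk cd|h nk].
  apply: tau_sep => Y nY f; apply: (n_step_inj nY nk) => m g.
  by rewrite -!cmap_pull cd.
pose t m (g : corner k m) := tau_repr (h m g).
have vt : tau_valid (TFill nk t).
  move=> Y f nY; have [y hy] := n_step_fill nY (cmap_comp (tau_desc nY f) h) nk.
  exists y => m g; rewrite hy /= /t.
  by rewrite -[h m g in X in _ X]tau_reprK; exact: tau_desc_eval.
exists (tau_class vt) => m g; rewrite /= tau_pull_class.
rewrite -[RHS]tau_reprK; apply: tau_class_eq => Y f nY /=.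
have [z tz] := vt Y f nY.
apply/seteqP; split=> y /=; first by move=> [w tw <-]; exact: tw.
by move=> ty; exists z => //; apply: (tau_eval_uniq nY _ ty); exact: tz.
Qed.

Lemma tau_uniq Y (nY : n_step n Y) (g h : cmap tau_cubeset Y) :
  cmap_comp g tau_cunit = cmap_comp h tau_cunit -> g = h.
Proof.
suff key (u : cmap tau_cubeset Y) k (t : tau_term k) (v : tau_valid t) :
    tau_eval (cmap_comp u tau_cunit) t (u k (tau_class v)).
  move=> gh; apply: cmap_ext => k c; rewrite -[c]tau_reprK.
  apply: (tau_eval_uniq nY (f := cmap_comp g tau_cunit)); first exact: key.
  by rewrite gh; exact: key.
elim: t v => {k} [k c|k m a t IH|k nk w IH] v /=.
- by congr (u k _); exact: tau_class_eq.
- have vt : tau_valid t by move=> Z f nZ; have [_ [z tz _]] := v Z f nZ; exists z.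
  exists (u k (tau_class vt)) => //; rewrite -cmap_pull /= tau_pull_class.
  by congr (u m _); exact: tau_class_eq.
- move=> m a; have va : tau_valid (w m a).
    by move=> Z f nZ; have [z tz] := v Z f nZ; eexists; exact: tz.
  rewrite -cmap_pull /= tau_pull_class.
  rewrite (_ : tau_class _ = tau_class va) //; apply: tau_class_eq => Z f nZ /=.
  have [z tz] := v Z f nZ.
  apply/seteqP; split=> y /=; first by move=> [x tx <-]; exact: tx.
  by move=> ty; exists z => //; apply: (tau_eval_uniq nZ _ ty); exact: tz.
Qed.

End Tau.

Definition const_cube (Y : cubeset) (y0 : Y 0) k : Y k := pull (box_term k) y0.

Lemma pull_const (Y : cubeset) (y0 : Y 0) m k (f : boxHom m k) :
  pull f (const_cube y0 k) = const_cube y0 m.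
Proof.
by rewrite /const_cube -pull_comp; congr pull; exact: box_term_uniq.
Qed.

Definition const_on_corner (Y : cubeset) (y0 : Y 0) n (c : Y n) : Prop :=
  forall m (f : corner n m), pull (sval f) c = const_cube y0 m.

Definition pi_cubes (Y : cubeset) (y0 : Y 0) n : Type :=
  {c : Y n | const_on_corner y0 c}.

Definition pi_one (Y : cubeset) (y0 : Y 0) n : pi_cubes y0 n :=
  exist (@const_on_corner Y y0 n) (const_cube y0 n)
    (fun m f => pull_const y0 (sval f)).

Lemma pi_face (Y : cubeset) (y0 : Y 0) n (a : pi_cubes y0 n) m (f : boxHom m n) i :
  (forall x, f x i = false) -> pull f (sval a) = const_cube y0 m.
Proof.
move=> fi; have cf : in_corner f.
  by exists i, (box_comp (box_drop i) f); exact: eps_drop.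
exact: (svalP a m (exist _ f cf)).
Qed.

(* The product of a and b in pi_(n+1) is the restriction of the unique such d
   along [dup] ([pi_mul_ex], [pi_mulE]). *)
Definition pi_mul_cube (Y : cubeset) (y0 : Y 0) n (a b : pi_cubes y0 n.+1) : set (Y n.+2) :=
  [set d | [/\ pull (eps (ord0 : 'I_n.+2)) d = sval a,
               pull (eps (lift ord0 ord0 : 'I_n.+2)) d = sval b
             & forall i : 'I_n.+2, (2 <= i)%N -> pull (eps i) d = const_cube y0 n.+1]].

Section PiMul.
Variables (n : nat) (Y : cubeset) (nY : n_step n.+1 Y) (y0 : Y 0).
Implicit Types a b : pi_cubes y0 n.+1.

Let i0 : 'I_n.+2 := ord0.
Let i1 : 'I_n.+2 := lift ord0 ord0.

Definition pi_corner_fun a b m (f : corner n.+2 m) : Y m :=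
  if `[< forall x, sval f x i0 = false >] then
    pull (box_comp (box_drop i0) (sval f)) (sval a)
  else if `[< forall x, sval f x i1 = false >] then
    pull (box_comp (box_drop i1) (sval f)) (sval b)
  else const_cube y0 m.

Lemma pi_drop_const a (i j : 'I_n.+2) m (f : boxHom m n.+2) : i != j ->
  (forall x, f x j = false) ->
  pull (box_comp (box_drop i) f) (sval a) = const_cube y0 m.
Proof.
move=> ij fj; have [k jk _] := unlift_some ij.
by apply: (@pi_face _ _ _ _ _ _ k) => x; rewrite /= ffunE -jk.
Qed.

Lemma in_corner_zero m k (f : corner k m) : exists i, forall x, sval f x i = false.
Proof. by case: f => f [i [g e]]; exists i => x; rewrite /= e; exact: eps_at. Qed.

Lemma pi_corner_pull a b p m (g : boxHom p m) (f : corner n.+2 m) :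
  pi_corner_fun a b (pull g f) = pull g (pi_corner_fun a b f).
Proof.
rewrite /pi_corner_fun; case: asboolP => [h0|h0].
  case: asboolP => f0; first by rewrite -pull_comp; congr pull; exact: boxHom_ext.
  have [i hi] := in_corner_zero f.
  have ii0 : i0 != i by apply/eqP => e; apply: f0; rewrite e.
  rewrite (@pi_drop_const _ _ _ _ _ ii0); last by move=> x; exact: hi.
  case: asboolP => f1; last by rewrite pull_const.
  rewrite -pull_comp; apply/esym.
  rewrite (_ : box_comp _ g = box_comp (box_drop i1) (box_comp (sval f) g));
    last exact: boxHom_ext.
  exact: (@pi_drop_const _ _ i0).
case: (asboolP (forall x, sval f x i0 = false)) => [f0|f0].
  by exfalso; apply: h0 => x; exact: f0.
case: asboolP => [h1|h1].
  case: asboolP => f1; first by rewrite -pull_comp; congr pull; exact: boxHom_ext.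
  have [i hi] := in_corner_zero f.
  have ii1 : i1 != i by apply/eqP => e; apply: f1; rewrite e.
  by rewrite pull_const (@pi_drop_const _ _ _ _ _ ii1)// => x; exact: hi.
case: asboolP => [f1|f1]; last by rewrite pull_const.
by exfalso; apply: h1 => x; exact: f1.
Qed.

Lemma eps_corner k (i : 'I_k) : in_corner (eps i).
Proof. by exists i, (box_id _); exact: boxHom_ext. Qed.

Lemma epsT k (i j : 'I_k) : i != j -> exists x, eps i x j = true.
Proof.
move=> ij; exists [ffun => true]; rewrite ffunE.
by have [l -> ->] := unlift_some ij; rewrite ffunE.
Qed.

Lemma drop_eps k (i : 'I_k) : box_comp (box_drop i) (eps i) = box_id _.
Proof.
by apply: boxHom_ext => x; apply/ffunP => j; rewrite !ffunE liftK.
Qed.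

Lemma pi_mul_ex a b : exists! d, pi_mul_cube a b d.
Proof.
have [d hd] := n_step_fill nY
  (@Cmap (corner n.+2) Y (fun m f => pi_corner_fun a b f) (pi_corner_pull a b))
  (ltnSn n.+1).
have hdE (i : 'I_n.+2) := hd _ (exist _ _ (eps_corner i)).
exists d; split.
  split.
  - rewrite (hdE ord0) /= /pi_corner_fun /= asboolT; last by move=> x; exact: eps_at.
    by rewrite (drop_eps i0) pull_id.
  - rewrite (hdE i1) /= /pi_corner_fun /= asboolF; last first.
      by have [//|x e] := @epsT _ i1 i0 => /(_ x); rewrite e.
    rewrite asboolT; last by move=> x; exact: eps_at.
    by rewrite (drop_eps i1) pull_id.
  - move=> i i2; rewrite (hdE i) /= /pi_corner_fun /= !asboolF//.
      have [|x e] := @epsT _ i i1; first by apply/eqP => e; rewrite e in i2.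
      by move=> /(_ x); rewrite e.
    have [|x e] := @epsT _ i i0; first by apply/eqP => e; rewrite e in i2.
    by move=> /(_ x); rewrite e.
move=> d' [d0 d1 d2]; apply: (n_step_inj nY (ltnSn n.+1)) => m [f [i [g e]]] /=.
rewrite e {f e}.
rewrite !pull_comp; congr pull; rewrite (hdE i) /= /pi_corner_fun /=.
have [ei|i_0] := eqVneq i i0.
  rewrite ei asboolT; last by move=> x; exact: eps_at.
  by rewrite (drop_eps i0) pull_id -d0.
rewrite asboolF; last by have [//|x e] := @epsT _ i i0 => /(_ x); rewrite e.
have [ei|i_1] := eqVneq i i1.
  rewrite ei asboolT; last by move=> x; exact: eps_at.
  by rewrite (drop_eps i1) pull_id -d1.
rewrite asboolF; last by have [//|x e] := @epsT _ i i1 => /(_ x); rewrite e.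
by rewrite d2//; move: i_0 i_1; case: i => -[|[|i]].
Qed.

Lemma pi_mul_subproof a b d : pi_mul_cube a b d ->
  const_on_corner y0 (pull (dup n) d).
Proof.
move=> [d0 d1 d2] m f; rewrite -pull_comp.
have [i hi] := in_corner_zero f.
have sE : forall x, dup n (sval f x) (lift ord0 i) = false.
  by move=> x; rewrite ffunE liftK hi.
have [ei|i_0] := eqVneq i ord0; last first.
  rewrite (@eps_drop _ _ (lift ord0 i) (box_comp (dup n) (sval f)))//.
  rewrite pull_comp d2 ?pull_const//; rewrite /= /bump /= add1n ltnS lt0n.
  by move: i_0; apply: contraNN => /eqP ?; apply/eqP/val_inj.
have s0 : forall x, dup n (sval f x) ord0 = false.
  by move=> x; rewrite ffunE unlift_none -ei hi.
rewrite (@eps_drop _ _ ord0 (box_comp (dup n) (sval f)))// pull_comp d0.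
exact: (@pi_drop_const _ ord0 (lift ord0 i)).
Qed.

Definition pi_mul a b : pi_cubes y0 n.+1 :=
  let d := cid (ex_intro _ _ (proj1 (svalP (cid (pi_mul_ex a b))))) in
  exist _ (pull (dup n) (sval d)) (pi_mul_subproof (svalP d)).

Lemma pi_mulE a b d : pi_mul_cube a b d -> sval (pi_mul a b) = pull (dup n) d.
Proof.
move=> abd; rewrite /pi_mul /=; case: (cid (ex_intro _ _ _)) => d' /= abd'.
have [e [_ eU]] := pi_mul_ex a b.
by rewrite -(eU _ abd) -(eU _ abd').
Qed.

End PiMul.

Definition abelian_group_law T (op : T -> T -> T) (e : T) : Prop :=
  [/\ associative op, commutative op, left_id e op
    & forall a, exists b, op b a = e].

Section ZmodOf.
Variables (T : Type) (op : T -> T -> T) (e : T) (H : abelian_group_law op e).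

Definition zmod_carrier (_ : abelian_group_law op e) : Type := T.

HB.instance Definition _ := gen_eqMixin (zmod_carrier H).
HB.instance Definition _ := gen_choiceMixin (zmod_carrier H).

Let inv_ex : forall a, exists b, op b a = e. Proof. by case: H. Qed.
Let opp (a : zmod_carrier H) : zmod_carrier H := sval (cid (inv_ex a)).
Let addA : associative (op : zmod_carrier H -> zmod_carrier H -> zmod_carrier H).
Proof. by case: H. Qed.
Let addC : commutative (op : zmod_carrier H -> zmod_carrier H -> zmod_carrier H).
Proof. by case: H. Qed.
Let add0 : left_id (e : zmod_carrier H) op. Proof. by case: H. Qed.
Let addN : left_inverse (e : zmod_carrier H) opp op.
Proof. by move=> a; exact: (svalP (cid (inv_ex a))). Qed.

HB.instance Definition _ :=
  GRing.isZmodule.Build (zmod_carrier H) addA addC add0 addN.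

Definition zmod_of : zmodType := zmod_carrier H.

End ZmodOf.

Section PiMap.
Variables (n : nat) (Y Z : cubeset) (nY : n_step n.+1 Y) (nZ : n_step n.+1 Z).
Variables (y0 : Y 0) (z0 : Z 0) (f : cmap Y Z) (fy0 : f 0 y0 = z0).

Lemma cmap_const k : f k (const_cube y0 k) = const_cube z0 k.
Proof. by rewrite /const_cube cmap_pull fy0. Qed.

Lemma pi_map_subproof (a : pi_cubes y0 n.+1) :
  const_on_corner z0 (f n.+1 (sval a)).
Proof. move=> m g; by rewrite -cmap_pull (svalP a) cmap_const. Qed.

Definition pi_map (a : pi_cubes y0 n.+1) : pi_cubes z0 n.+1 :=
  exist _ (f n.+1 (sval a)) (pi_map_subproof a).

Lemma pi_mapM a b : pi_map (pi_mul nY a b) = pi_mul nZ (pi_map a) (pi_map b).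
Proof.
have [d [abd _]] := pi_mul_ex nY a b; apply: sig_ext.
rewrite -[LHS]/(f n.+1 (sval (pi_mul nY a b))) (pi_mulE nY abd).
rewrite (@pi_mulE _ _ nZ _ _ _ (f n.+2 d)) ?cmap_pull//.
case: abd => d0 d1 d2; split; rewrite -?cmap_pull ?d0 ?d1// => i i2.
by rewrite -cmap_pull d2// cmap_const.
Qed.

Variables (HY : abelian_group_law (pi_mul nY (y0 := y0)) (pi_one y0 n.+1))
          (HZ : abelian_group_law (pi_mul nZ (y0 := z0)) (pi_one z0 n.+1)).

Definition pi_hom : zmod_of HY -> zmod_of HZ := pi_map.

Lemma pi_hom_additive : zmod_morphism pi_hom.
Proof.
move=> a b; apply: (addIr (pi_hom b)); rewrite subrK.
by rewrite -[in RHS](subrK b a); exact/esym/(pi_mapM (a - b) b).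
Qed.

HB.instance Definition _ :=
  GRing.isZmodMorphism.Build (zmod_of HY) (zmod_of HZ) pi_hom pi_hom_additive.

End PiMap.

Section DCubes.
Variables (k : nat) (A : zmodType).

(* A face is given by the coordinates it fixes, with their values *)
Definition face n (p : {ffun 'I_n -> option bool}) : pred (cube n) :=
  [pred x : cube n | [forall i, (p i == None) || (p i == Some (x i))]].

Definition face_dim n (p : {ffun 'I_n -> option bool}) : nat :=
  #|[set i | p i == None]%SET|.

Definition is_subgroup (V : zmodType) (H : set V) : Prop :=
  H 0 /\ forall x y, H x -> H y -> H (x - y).

(* Truncated subtraction is harmless: dimensions are nonnegative. *)
Definition D_generators n : set {ffun cube n -> A} :=
  [set f | exists (a : A) (p : {ffun 'I_n -> option bool}),
     (n - k <= face_dim p)%N /\ f = [ffun x => if face p x then a else 0]].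

Definition D_sub n : set {ffun cube n -> A} :=
  smallest (@is_subgroup {ffun cube n -> A}) (@D_generators n).

Lemma D_sub_subgroup n : is_subgroup (@D_sub n).
Proof.
split=> [H [[H0 _] _] //|x y Hx Hy H HH].
by have [[_ HB] _] := HH; apply: HB; [exact: Hx|exact: Hy].
Qed.

Lemma D_sub_gen n f : D_generators (n := n) f -> D_sub f.
Proof. by move=> gf H [_]; exact. Qed.

Lemma D_sub_ind n (H : set {ffun cube n -> A}) :
  is_subgroup H -> D_generators (n := n) `<=` H -> D_sub (n := n) `<=` H.
Proof. by move=> HH gH f; apply. Qed.

End DCubes.

(* An affine map between cubes has output coordinates depending on at most one
   input coordinate. *)
Lemma box_coord m n (f : boxHom m n) (j : 'I_n) :
  exists d : option 'I_m, forall x y : cube m,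
    (f x j == f y j) = (if d is Some l then x l == y l else true).
Proof.
case: f => f [A [b fE]] /=.
have {}fE x : (nat_of_bool (f x j))%:Z = \sum_l (nat_of_bool (x l))%:Z * A l j + b 0 j.
  have /(congr1 (fun u : 'rV_n => u 0 j)) := fE x; rewrite !mxE => ->.
  by congr (_ + _); apply: eq_bigr => l _; rewrite !mxE.
have atmost l l' : A l j != 0 -> A l' j != 0 -> l = l'.
  move=> Al Al'; apply/eqP/negPn/negP => ll'.
  have f0 := fE [ffun => false]; have fl := fE [ffun i => i == l].
  have fl' := fE [ffun i => i == l'].
  have fll' := fE [ffun i => (i == l) || (i == l')].
  rewrite big1 in f0; last by move=> i _; rewrite ffunE mul0r.
  have sum1 (r : 'I_m) : \sum_i ([ffun i => i == r] i : nat)%:Z * A i j = A r j.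
    rewrite (bigD1 r) //= ffunE eqxx mul1r big1 ?addr0// => i ir.
    by rewrite ffunE (negbTE ir) mul0r.
  rewrite sum1 in fl; rewrite sum1 in fl'.
  have sum2 : \sum_i ([ffun i => (i == l) || (i == l')] i : nat)%:Z * A i j
      = A l j + A l' j.
    rewrite -!sum1 -big_split /=; apply: eq_bigr => i _; rewrite !ffunE -mulrDl.
    congr (_ * _); have [->|_] := eqVneq i l; last by rewrite add0r.
    by rewrite (negbTE ll').
  rewrite sum2 in fll'.
  move: f0 fl fl' fll' Al Al'.
  by do 4![case: (f _ j)] => /=; lia.
have [[l Al]|noA] := pselect (exists l, A l j != 0).
  exists (Some l) => x y.
  have fx z : (nat_of_bool (f z j))%:Z = (nat_of_bool (z l))%:Z * A l j + b 0 j.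
    rewrite fE (bigD1 l) //= big1 ?addr0// => i il.
    have [->|Ai] := eqVneq (A i j) 0; first by rewrite mulr0.
    by move: il; rewrite (atmost i l Ai Al) eqxx.
  move: (fx x) (fx y) Al.
  by case: (f x j); case: (f y j); case: (x l); case: (y l) => //=; lia.
exists None => x y.
have fx z : (nat_of_bool (f z j))%:Z = b 0 j.
  rewrite fE big1 ?add0r// => i _.
  have [->|Ai] := eqVneq (A i j) 0; first by rewrite mulr0.
  by exfalso; apply: noA; exists i.
by move: (fx x) (fx y); case: (f x j); case: (f y j) => //= <-.
Qed.

Section DCubeset.
Variables (k : nat) (A : zmodType).

Definition ffun_pull m n (g : boxHom m n) (f : {ffun cube n -> A}) : {ffun cube m -> A} :=
  [ffun x => f (g x)].

Lemma D_gen_pull m n (g : boxHom m n) f :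
  D_generators k f -> D_sub k (ffun_pull g f).
Proof.
move=> [a [p [pk ->]]].
have [[x0 px0]|nox] := pselect (exists x0, face p (g x0)); last first.
  rewrite (_ : ffun_pull _ _ = 0); first by have [] := D_sub_subgroup k A m.
  by apply/ffunP => x; rewrite !ffunE; case: ifP => // px; case: nox; exists x.
have [d dP] := choice (box_coord g).
pose L := [set l : 'I_m | [exists j, (p j != None) && (d j == Some l)]]%SET.
pose q := [ffun l : 'I_m => if l \in L then Some (x0 l) else None].
apply: D_sub_gen; exists a, q; split.
  have Lk : (#|L| <= k)%N.
    have : (#|L| <= #|[set j | p j != None]%SET|)%N.
      rewrite -(card_imset _ Some_inj).
      apply: (@leq_trans #|[set d j | j in [set j | p j != None]%SET]%SET|); last exact: leq_imset_card.
      apply/subset_leq_card/fintype.subsetP => _ /imsetP[l + ->].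
      rewrite inE => /existsP[j /andP[pj /eqP <-]].
      by apply/imsetP; exists j => //; rewrite inE.
    have := cardsC [set j | p j == None]%SET.
    rewrite (_ : ~: _ = [set j | p j != None]%SET)%SET; last by apply/finset.setP => j; rewrite !inE.
    by move: pk; rewrite /face_dim card_ord; lia.
  have := cardsC [set l | q l == None]%SET.
  rewrite (_ : ~: _ = L)%SET ?card_ord.
    by move=> mE; rewrite -[X in (X - k)%N]mE leq_subLR addnC leq_add2r.
  by apply/finset.setP => l; rewrite !inE ffunE inE; case: ifP.
apply/ffunP => x; rewrite !ffunE; congr (if _ then _ else _).
apply/forallP/forallP => h i.
- rewrite ffunE; case: ifPn => //; rewrite inE => /existsP[j /andP[pj /eqP dj]].
  have := h j; have := forallP px0 j; rewrite (negbTE pj) /= => /eqP -> /eqP[gx].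
  by have := dP j x0 x; rewrite gx eqxx dj => /esym/eqP ->.
- have [//|pi /=] := eqVneq (p i) None.
  have := forallP px0 i; rewrite (negbTE pi) /= => /eqP ->.
  apply/eqP; congr Some; apply/eqP; rewrite dP.
  case di : (d i) => [l|//].
  have := h l; rewrite ffunE inE ifT; last by apply/existsP; exists i; rewrite pi di eqxx.
  by move=> /eqP[->].
Qed.

Lemma D_sub_pull m n (g : boxHom m n) f :
  D_sub k f -> D_sub k (ffun_pull g f).
Proof.
have [D0 DB] := D_sub_subgroup k A m.
apply: (D_sub_ind (H := [set f | D_sub k (ffun_pull g f)])); last exact: D_gen_pull.
split=> /= [|x y Dx Dy].
  by rewrite (_ : ffun_pull _ _ = 0)//; apply/ffunP => x; rewrite !ffunE.
rewrite (_ : ffun_pull _ _ = ffun_pull g x - ffun_pull g y); first exact: DB.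
by apply/ffunP => z; rewrite !ffunE.
Qed.

Program Definition D_cubeset : cubeset :=
  @Cubeset (fun n => {f : {ffun cube n -> A} | D_sub k f})
    (fun m n g f => exist _ (ffun_pull g (sval f)) (D_sub_pull g (svalP f))) _ _.
Next Obligation. by move=> n f; apply: sig_ext; apply/ffunP => x; rewrite ffunE. Qed.
Next Obligation.
by move=> m n p g h f; apply: sig_ext; apply/ffunP => x; rewrite !ffunE.
Qed.

End DCubeset.

Definition card_lt T U (A : set T) (B : set U) : Prop :=
  (A #<= B)%card /\ ~ (B #<= A)%card.

(* Uncountable strong limit cardinals, represented by a type of that
   cardinality; smaller cardinals are those of its smaller subsets. *)
Record strong_limit := StrongLimit {
  slim_card :> Type;
  slim_uncountable : ~ countable [set: slim_card];
  slim_power : forall A : set slim_card, card_lt A [set: slim_card] ->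
    card_lt [set B : set slim_card | B `<=` A] [set: slim_card] }.

Definition extremally_disconnected (T : topologicalType) : Prop :=
  forall U : set T, open U -> open (closure U).

(* The weight is the least cardinality of a basis. *)
Definition weight_lt (kappa : strong_limit) (T : topologicalType) : Prop :=
  exists2 B : set (set T), basis B & card_lt B [set: kappa].

Record extr (kappa : strong_limit) := Extr {
  extr_space :> topologicalType;
  extr_compact : compact [set: extr_space];
  extr_hausdorff : hausdorff_space extr_space;
  extr_ed : extremally_disconnected extr_space;
  extr_weight : weight_lt kappa extr_space }.

Section Point.
Variable kappa : strong_limit.
Let point : topologicalType := discrete_topology unit.

Let point_compact : compact [set: point].
Proof. by apply: finite_compact; exact: finite_finset. Qed.

Let point_hausdorff : hausdorff_space point.
Proof. exact: discrete_hausdorff. Qed.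

Let point_ed : extremally_disconnected point.
Proof. by move=> U _; exact: discrete_open. Qed.

Let point_weight : weight_lt kappa point.
Proof.
exists [set setT].
  split=> [_ -> |[] A /nbhs_singleton At]; first exact: openT.
  by exists setT => // -[].
have fin : finite_set [set [set: point]] by exact: finite_set1.
split.
  apply: card_le_trans (finite_set_countable fin) _; apply/infiniteP => Kfin.
  exact: (slim_uncountable (finite_set_countable Kfin)).
move=> le; apply: (slim_uncountable (s := kappa)).
by apply: card_le_trans le _; exact: finite_set_countable.
Qed.

Definition extr_pt : extr kappa :=
  Extr point_compact point_hausdorff point_ed point_weight.

End Point.

Definition extr_to_pt kappa (E : extr kappa) : continuousType E (extr_pt kappa) :=
  cst (tt : extr_pt kappa).

Section CubePresheaves.
Variable kappa : strong_limit.

(* Functors from extr(kappa)^op to cubesets; condensed cubesets are those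
   satisfying [condensed] below, with all maps of presheaves between them. *)
Record cubePsh := CubePsh {
  psh_at :> extr kappa -> cubeset;
  psh_res : forall E E' : extr kappa,
    continuousType E' E -> cmap (psh_at E) (psh_at E');
  psh_res_id : forall (E : extr kappa) k (c : psh_at E k),
    psh_res (@idfun E : continuousType E E) k c = c;
  psh_res_comp : forall (E E' E'' : extr kappa) (f : continuousType E' E)
    (g : continuousType E'' E') k (c : psh_at E k),
    psh_res (f \o g : continuousType E'' E) k c = psh_res g k (psh_res f k c) }.
Arguments psh_res _ {E E'} _.

Definition is_initial (E : extr kappa) : Prop :=
  forall Z : extr kappa, exists! f : continuousType E Z, True.

Definition is_coproduct (E1 E2 E : extr kappa)
    (i1 : continuousType E1 E) (i2 : continuousType E2 E) : Prop :=
  forall (Z : extr kappa) (f1 : continuousType E1 Z) (f2 : continuousType E2 Z),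
    exists! f : continuousType E Z, f \o i1 = f1 :> (_ -> _) /\ f \o i2 = f2 :> (_ -> _).

(* Preservation of finite products, for a contravariant functor and with the
   products of cubesets computed levelwise *)
Definition condensed (X : cubePsh) : Prop :=
  (forall E, is_initial E -> forall k, exists! c : X E k, True) /\
  (forall (E1 E2 E : extr kappa) (i1 : continuousType E1 E) (i2 : continuousType E2 E),
    is_coproduct i1 i2 -> forall k (c1 : X E1 k) (c2 : X E2 k),
      exists! c : X E k, psh_res X i1 k c = c1 /\ psh_res X i2 k c = c2).

Record pshMap (X Y : cubePsh) := PshMap {
  map_at :> forall E, cmap (X E) (Y E);
  map_res : forall (E E' : extr kappa) (f : continuousType E' E) k (c : X E k),
    map_at E' k (psh_res X f k c) = psh_res Y f k (map_at E k c) }.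

Lemma pshMap_ext X Y (f g : pshMap X Y) : (forall E k (c : X E k), f E k c = g E k c) -> f = g.
Proof.
case: f g => [f hf] [g hg] /= fg.
have {}fg : f = g.
  by apply: functional_extensionality_dep => E; apply: cmap_ext => k c.
by case: g / fg hg => hg; congr PshMap; exact: Prop_irrelevance.
Qed.

Definition psh_id (X : cubePsh) : pshMap X X :=
  @PshMap X X (fun E => cmap_id (X E)) (fun _ _ _ _ _ => erefl).

Program Definition psh_comp X Y Z (g : pshMap Y Z) (f : pshMap X Y) : pshMap X Z :=
  @PshMap X Z (fun E => cmap_comp (g E) (f E)) _.
Next Obligation. by move=> *; rewrite /= !map_res. Qed.

Definition is_iso X Y (f : pshMap X Y) : Prop :=
  exists g : pshMap Y X, psh_comp g f = psh_id X /\ psh_comp f g = psh_id Y.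

Program Definition psh_pt : cubePsh :=
  @CubePsh (fun E => @Cubeset (fun _ => unit) (fun _ _ _ c => c) _ _)
    (fun E E' f => @Cmap _ _ (fun _ c => c) _) _ _.
Solve All Obligations with by [].

Program Definition to_pt (X : cubePsh) : pshMap X psh_pt :=
  @PshMap X psh_pt (fun E => @Cmap (X E) (psh_pt E) (fun _ _ => tt) _) _.
Solve All Obligations with by [].

Program Definition psh_prod (X Y : cubePsh) : cubePsh :=
  @CubePsh (fun E => @Cubeset (fun k => X E k * Y E k)%type
      (fun m n f c => (pull f c.1, pull f c.2)) _ _)
    (fun E E' f => @Cmap _ _ (fun k c => (psh_res X f k c.1, psh_res Y f k c.2)) _) _ _.
Next Obligation. by move=> X Y E n [c d]; rewrite !pull_id. Qed.
Next Obligation. by move=> X Y E m n p g f [c d]; rewrite !pull_comp. Qed.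
Next Obligation. by move=> X Y E E' f m n g [c d] /=; rewrite !cmap_pull. Qed.
Next Obligation. by move=> X Y E k [c d] /=; rewrite !psh_res_id. Qed.
Next Obligation. by move=> X Y E E' E'' f g k [c d] /=; rewrite !psh_res_comp. Qed.

Program Definition psh_snd (X Y : cubePsh) : pshMap (psh_prod X Y) Y :=
  @PshMap _ _ (fun E => @Cmap (psh_prod X Y E) (Y E) (fun k c => c.2) _) _.
Solve All Obligations with by [].

Section Pullback.
Variables (X Y B : cubePsh) (f : pshMap X B) (g : pshMap Y B).

Program Definition psh_pullback : cubePsh :=
  @CubePsh (fun E => @Cubeset (fun k => {c : X E k * Y E k | f E k c.1 = g E k c.2})
      (fun m n h c => exist _ (pull h (sval c).1, pull h (sval c).2) _) _ _)
    (fun E E' h => @Cmap _ _ (fun k c =>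
      exist _ (psh_res X h k (sval c).1, psh_res Y h k (sval c).2) _) _) _ _.
Next Obligation. by move=> E m n h [[c d] /= e]; rewrite !cmap_pull e. Qed.
Next Obligation. by move=> E n [[c d] e]; apply: sig_ext; rewrite /= !pull_id. Qed.
Next Obligation. by move=> E m n p h u [[c d] e]; apply: sig_ext; rewrite /= !pull_comp. Qed.
Next Obligation. by move=> E E' h k [[c d] /= e]; rewrite !map_res e. Qed.
Next Obligation. by move=> E E' h m n u [[c d] e]; apply: sig_ext; rewrite /= !cmap_pull. Qed.
Next Obligation. by move=> E k [[c d] e]; apply: sig_ext; rewrite /= !psh_res_id. Qed.
Next Obligation. by move=> E E' E'' h u k [[c d] e]; apply: sig_ext; rewrite /= !psh_res_comp. Qed.

Variables (Z : cubePsh) (u : pshMap Z X) (v : pshMap Z Y).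
Hypothesis uv : psh_comp f u = psh_comp g v.

Program Definition psh_pair : pshMap Z psh_pullback :=
  @PshMap Z psh_pullback (fun E => @Cmap (Z E) (psh_pullback E)
    (fun k c => exist _ (u E k c, v E k c) _) _) _.
Next Obligation.
by move=> E k c; exact: (congr1 (fun w : pshMap Z B => w E k c) uv).
Qed.
Next Obligation. by move=> E m n h c; apply: sig_ext; rewrite /= !cmap_pull. Qed.
Next Obligation. by move=> E E' h k c; apply: sig_ext; rewrite /= !map_res. Qed.

End Pullback.

(* Maps of condensed sets are epi- or monomorphisms iff they are surjective or
   injective on E-points for all E. *)
Definition surjective X Y (f : pshMap X Y) : Prop :=
  forall E k (y : Y E k), exists x : X E k, f E k x = y.

Definition concrete (X : cubePsh) : Prop :=
  forall E k, injective (fun (c : X E k) (v : cube k) => pull (vertex v) c).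

Definition fibration X Y (f : pshMap X Y) : Prop :=
  forall k, (0 < k)%N -> forall E (h : cmap (corner k) (X E)) (y : Y E k),
    cmap_comp (f E) h = corner_restr y ->
    exists x : X E k, corner_restr x = h /\ f E k x = y.

Definition fibrant (X : cubePsh) : Prop := fibration (to_pt X).

Definition psh_n_step (n : nat) (X : cubePsh) : Prop := forall E, n_step n (X E).

Section TauPsh.
Variables (n : nat) (X : cubePsh).

Definition tau_res (E E' : extr kappa) (f : continuousType E' E) :
    cmap (tau_cubeset n (X E)) (tau_cubeset n (X E')) :=
  tau_desc (@tau_n_step n (X E')) (cmap_comp (tau_cunit n (X E')) (psh_res X f)).

Lemma tau_desc_at Y (nY : n_step n Y) E (f : cmap (X E) Y) k (c : X E k) :
  tau_desc nY f k (tau_cunit n (X E) k c) = f k c.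
Proof. exact: (congr1 (fun w : cmap _ _ => w k c) (tau_desc_unit nY f)). Qed.

Lemma tau_res_unit (E E' : extr kappa) (f : continuousType E' E) k (c : X E k) :
  tau_res f k (tau_cunit n (X E) k c) = tau_cunit n (X E') k (psh_res X f k c).
Proof. exact: tau_desc_at. Qed.

Lemma tau_uniq_at Y (nY : n_step n Y) E (g h : cmap (tau_cubeset n (X E)) Y) :
  (forall k c, g k (tau_cunit n (X E) k c) = h k (tau_cunit n (X E) k c)) ->
  forall k c, g k c = h k c.
Proof.
move=> gh k c; suff -> : g = h by [].
by apply: (tau_uniq nY); apply: cmap_ext => l d; exact: gh.
Qed.

(* The left adjoint is computed pointwise; its universal property is
   [tau_lift_unit] and [tau_lift_uniq]. *)
Program Definition tau : cubePsh :=
  @CubePsh (fun E => tau_cubeset n (X E)) tau_res _ _.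
Next Obligation.
move=> E; apply: (@tau_uniq_at _ (@tau_n_step n (X E)) E _ (cmap_id _)) => k c.
by rewrite tau_res_unit psh_res_id.
Qed.
Next Obligation.
move=> E E' E'' f g.
apply: (@tau_uniq_at _ (@tau_n_step n _) E _ (cmap_comp (tau_res g) (tau_res f))) => k c.
rewrite -[RHS]/(tau_res g k (tau_res f k _)) !tau_res_unit.
by rewrite (psh_res_comp f g).
Qed.

Program Definition tau_unit : pshMap X tau :=
  @PshMap X tau (fun E => tau_cunit n (X E)) _.
Next Obligation. by move=> E E' f k c; rewrite [RHS]tau_desc_at. Qed.

Program Definition tau_lift (Y : cubePsh) (nY : psh_n_step n Y) (f : pshMap X Y) :
    pshMap tau Y :=
  @PshMap tau Y (fun E => tau_desc (nY E) (f E)) _.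
Next Obligation.
move=> Y nY f E E' g.
apply: (@tau_uniq_at _ (nY E') E (cmap_comp (tau_desc (nY E') (f E')) (tau_res g))
  (cmap_comp (psh_res Y g) (tau_desc (nY E) (f E)))) => k c.
rewrite -[LHS]/(tau_desc _ _ k (tau_res g k _)) tau_res_unit !tau_desc_at.
by rewrite -[RHS]/(psh_res Y g k (tau_desc _ _ k _)) tau_desc_at map_res.
Qed.

Lemma tau_psh_n_step : psh_n_step n tau.
Proof. by move=> E; exact: tau_n_step. Qed.

Lemma tau_lift_unit Y (nY : psh_n_step n Y) (f : pshMap X Y) :
  psh_comp (tau_lift nY f) tau_unit = f.
Proof. by apply: pshMap_ext => E k c; exact: tau_desc_at. Qed.

Lemma tau_lift_uniq Y (nY : psh_n_step n Y) (g h : pshMap tau Y) :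
  psh_comp g tau_unit = psh_comp h tau_unit -> g = h.
Proof.
move=> gh; apply: pshMap_ext => E.
apply: (tau_uniq_at (nY E)) => k c.
exact: (congr1 (fun w : pshMap X Y => w E k c) gh).
Qed.

End TauPsh.

Definition tau_map n X Y (f : pshMap X Y) : pshMap (tau n X) (tau n Y) :=
  tau_lift (@tau_psh_n_step n Y) (psh_comp (tau_unit n Y) f).

Lemma psh_n_step_le m n X : (m <= n)%N -> psh_n_step m X -> psh_n_step n X.
Proof. by move=> mn mX E k nk; apply: mX; exact: leq_ltn_trans nk. Qed.

(* The map tau_(n+1) X -> tau_n X is the unit of tau_n at tau_(n+1) X, as
   tau_n tau_(n+1) X = tau_n X. *)
Definition tau_proj n X : pshMap (tau n.+1 X) (tau n X) :=
  tau_lift (psh_n_step_le (leqnSn n) (@tau_psh_n_step n X)) (tau_unit n X).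

Definition ergodic (X : cubePsh) : Prop := is_iso (to_pt (tau 0 X)).

Record abPsh := AbPsh {
  ab_at :> extr kappa -> zmodType;
  ab_res : forall E E' : extr kappa,
    continuousType E' E -> {additive ab_at E -> ab_at E'};
  ab_res_id : forall (E : extr kappa) (a : ab_at E),
    ab_res (@idfun E : continuousType E E) a = a;
  ab_res_comp : forall (E E' E'' : extr kappa) (f : continuousType E' E)
    (g : continuousType E'' E') (a : ab_at E),
    ab_res (f \o g : continuousType E'' E) a = ab_res g (ab_res f a) }.

Definition base_point (X : cubePsh) : Type := X (extr_pt kappa) 0.

Section PiPsh.
Variables (n : nat) (X : cubePsh) (x0 : base_point X).

Definition tau_base (E : extr kappa) : tau n.+1 X E 0 :=
  tau_unit n.+1 X E 0 (psh_res X (extr_to_pt E) 0 x0).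

Lemma tau_base_res (E E' : extr kappa) (f : continuousType E' E) :
  psh_res (tau n.+1 X) f 0 (tau_base E) = tau_base E'.
Proof.
rewrite /tau_base -map_res -psh_res_comp; congr (tau_unit _ _ _ _ (psh_res _ _ _ _)).
by apply/continuousEP.
Qed.

(* The index is shifted: this is about pi_(n+1)(X, x0). *)
Definition pi_abelian : Prop := forall E,
  abelian_group_law (pi_mul (@tau_n_step n.+1 (X E)) (y0 := tau_base E))
    (pi_one (tau_base E) n.+1).

Program Definition pi_ab (H : pi_abelian) : abPsh :=
  @AbPsh (fun E => zmod_of (H E))
    (fun E E' f => @pi_hom n _ _ _ _ _ _ (psh_res (tau n.+1 X) f) (tau_base_res f) (H E) (H E'))
    _ _.
Next Obligation.
by move=> H E a; apply: sig_ext; exact: (@psh_res_id (tau n.+1 X)).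
Qed.
Next Obligation.
by move=> H E E' E'' f g a; apply: sig_ext; exact: (@psh_res_comp (tau n.+1 X)).
Qed.

End PiPsh.

Record groupObj := GroupObj {
  grp_psh :> cubePsh;
  grp_mul : pshMap (psh_prod grp_psh grp_psh) grp_psh;
  grp_one : pshMap psh_pt grp_psh;
  grp_inv : pshMap grp_psh grp_psh;
  grp_mulA : forall E k (a b c : grp_psh E k),
    grp_mul E k (a, grp_mul E k (b, c)) = grp_mul E k (grp_mul E k (a, b), c);
  grp_mul1 : forall E k (a : grp_psh E k), grp_mul E k (grp_one E k tt, a) = a;
  grp_mulV : forall E k (a : grp_psh E k),
    grp_mul E k (grp_inv E k a, a) = grp_one E k tt }.

Section DPsh.
Variables (k : nat) (A : abPsh).

Definition D_res_fun (E E' : extr kappa) (h : continuousType E' E) n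
  (f : {ffun cube n -> A E}) : {ffun cube n -> A E'} := [ffun x => ab_res A h (f x)].

Lemma D_sub_res (E E' : extr kappa) (h : continuousType E' E) n (f : {ffun cube n -> A E}) :
  D_sub k f -> D_sub k (D_res_fun h f).
Proof.
have [D0 DB] := D_sub_subgroup k (A E') n.
apply: (D_sub_ind (H := [set f | D_sub k (D_res_fun h f)])).
  split=> /= [|x y Dx Dy].
    rewrite (_ : D_res_fun _ _ = 0)//.
    by apply/ffunP => x; rewrite !ffunE raddf0.
  rewrite (_ : D_res_fun _ _ = D_res_fun h x - D_res_fun h y); first exact: DB.
  by apply/ffunP => z; rewrite !ffunE raddfB.
move=> _ [a [p [pk ->]]] /=; apply: D_sub_gen; exists (ab_res A h a), p; split=> //.
by apply/ffunP => x; rewrite !ffunE; case: ifP; rewrite ?raddf0.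
Qed.

Program Definition D_psh : cubePsh :=
  @CubePsh (fun E => D_cubeset k (A E))
    (fun E E' h => @Cmap (D_cubeset k (A E)) (D_cubeset k (A E'))
      (fun n f => exist _ (D_res_fun h (sval f)) (D_sub_res h (svalP f))) _) _ _.
Next Obligation. by move=> *; apply: sig_ext; apply/ffunP => x; rewrite !ffunE. Qed.
Next Obligation. by move=> *; apply: sig_ext; apply/ffunP => x; rewrite !ffunE ab_res_id. Qed.
Next Obligation. by move=> *; apply: sig_ext; apply/ffunP => x; rewrite !ffunE ab_res_comp. Qed.

Lemma D_sub0 E n : D_sub (n := n) (A := A E) k 0.
Proof. by have [] := D_sub_subgroup k (A E) n. Qed.

Lemma D_subN E n (f : {ffun cube n -> A E}) : D_sub k f -> D_sub k (- f).
Proof.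
by have [D0 DB] := D_sub_subgroup k (A E) n => Df; rewrite -[- f]add0r; exact: DB.
Qed.

Lemma D_subD E n (f g : {ffun cube n -> A E}) : D_sub k f -> D_sub k g -> D_sub k (f + g).
Proof.
have [D0 DB] := D_sub_subgroup k (A E) n => Df Dg.
by rewrite -[g]opprK; apply: DB => //; exact: D_subN.
Qed.

Program Definition calD : groupObj :=
  @GroupObj D_psh
    (@PshMap _ D_psh (fun E => @Cmap (psh_prod D_psh D_psh E) (D_psh E)
      (fun n c => exist _ (sval c.1 + sval c.2) (D_subD (svalP c.1) (svalP c.2))) _) _)
    (@PshMap psh_pt D_psh (fun E => @Cmap (psh_pt E) (D_psh E)
      (fun n _ => exist _ 0 (@D_sub0 E n)) _) _)
    (@PshMap D_psh D_psh (fun E => @Cmap (D_psh E) (D_psh E)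
      (fun n c => exist _ (- sval c) (D_subN (svalP c))) _) _) _ _ _.
Next Obligation. by move=> *; apply: sig_ext; apply/ffunP => x; rewrite !ffunE. Qed.
Next Obligation. by move=> *; apply: sig_ext; apply/ffunP => x; rewrite !ffunE raddfD. Qed.
Next Obligation. by move=> *; apply: sig_ext; apply/ffunP => x; rewrite !ffunE. Qed.
Next Obligation. by move=> *; apply: sig_ext; apply/ffunP => x; rewrite !ffunE raddf0. Qed.
Next Obligation. by move=> *; apply: sig_ext; apply/ffunP => x; rewrite !ffunE. Qed.
Next Obligation. by move=> *; apply: sig_ext; apply/ffunP => x; rewrite !ffunE raddfN. Qed.
Next Obligation. by move=> *; apply: sig_ext; exact: addrA. Qed.
Next Obligation. by move=> *; apply: sig_ext; exact: add0r. Qed.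
Next Obligation. by move=> *; apply: sig_ext; exact: addNr. Qed.

End DPsh.

Definition is_coequalizer X Y Z (f g : pshMap X Y) (p : pshMap Y Z) : Prop :=
  psh_comp p f = psh_comp p g /\
  forall (T : cubePsh) (q : pshMap Y T), condensed T ->
    psh_comp q f = psh_comp q g -> exists! r : pshMap Z T, psh_comp r p = q.

Definition principal_bundle (G : groupObj) P B (p : pshMap P B) : Prop :=
  [/\ condensed G, condensed P & condensed B] /\
  exists (alpha : pshMap (psh_prod G P) P)
         (over : psh_comp p alpha = psh_comp p (psh_snd G P)),
    [/\ forall E k (x : P E k), alpha E k (grp_one G E k tt, x) = x,
        forall E k (a b : G E k) (x : P E k),
          alpha E k (grp_mul G E k (a, b), x) = alpha E k (a, alpha E k (b, x)),
        is_iso (psh_pair over)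
      & is_coequalizer alpha (psh_snd G P) p].

End CubePresheaves.

(* Main.v *)
(* A concrete fibrant cubeset is a nilspace, possibly of infinite step and not
   ergodic, and for those tau_n is the quotient by the relation ~_n of
   Camarena-Szegedy: x ~_n y iff the function on {0,1}^(n+1) with value y at the
   last vertex and x elsewhere is a cube. The key fact is that gluing cubes along
   a common face one coordinate at a time shows that, in a cube of dimension at
   most n+1, vertices may be replaced by ~_n-equivalent ones, while in a corner of
   dimension greater than n the last vertex of a filler is unique up to ~_n.
   Hence X -> X/~_n is a fibration onto a concrete n-step cubeset, corners lift
   along it, and every map to an n-step cubeset factors through it.

   In an ergodic N-step Y, a ~_(N-1) x acts on Y by translation: a.y is the unique
   point for which the pairs (y0,a) and (y,a.y) are parallel, i.e. span an
   (N+1)-cube. Parallelism composes in both directions, which gives the group law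
   of pi_N and the action. A function on {0,1}^k is a cube as soon as its
   (N+1)-dimensional restrictions are, which reduces the action of D_N(pi_N) on
   cubes to modifications along single edges of (N+1)-cubes; transitivity on
   the fibres follows by correcting the vertices of weight at most N with upper
   faces. Everything is natural in the test space, and tau_n preserves the
   relevant finite products since ~_n is witnessed by single cubes. *)
From mathcomp Require Import all_boot all_order all_algebra perm.
From mathcomp Require Import all_classical topology.
Require Import Defs.

Set Implicit Arguments.
Unset Strict Implicit.
Unset Printing Implicit Defensive.

Import GRing.Theory.

Local Open Scope classical_set_scope.

(** * Morphisms of cubes, and induction over the vertices of a cube *)

Section Select.
Variables (m n : nat) (s : 'I_n -> 'I_m * bool + bool).
Local Open Scope ring_scope.

(** An output coordinate is a constant or an input coordinate, negated if [ib.2] is set; unlike in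
    [affine_select], reflections are included. *)
Definition sel_fun (x : cube m) : cube n :=
  [ffun j => match s j with inl ib => ib.2 (+) x ib.1 | inr b => b end].

Lemma sel_affine : affine sel_fun.
Proof.
exists (\matrix_(i, j) match s j with
          | inl ib => if ib.1 == i then (if ib.2 then -1 else 1) else 0
          | inr _ => 0 end),
  (\row_j match s j with inl ib => (ib.2 : nat)%:Z | inr b => (b : nat)%:Z end).
move=> x; apply/rowP => j; rewrite !mxE ffunE.
under eq_bigr do rewrite !mxE.
case: (s j) => [[i b]|b] /=; last by rewrite big1 ?add0r// => i _; rewrite mulr0.
rewrite (bigD1 i) //= eqxx big1 ?addr0.
  by case: b; case: (x i).
by move=> l li; rewrite eq_sym (negbTE li) mulr0.
Qed.

Definition bsel : boxHom m n := BoxHom sel_affine.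

End Select.
Arguments box_fun : simpl never.

Definition ones k : cube k := [ffun => true].

Definition upd k T (h : cube k -> T) (w : cube k) (y : T) (x : cube k) : T :=
  if x == w then y else h x.

(** The retraction onto the lower face {x <= w}: [meet w v = v] encodes v <= w, and [g \o meet w] is
    the restriction of [g] to that face, spread over the whole cube so that the dimension does not
    change. *)
Definition meet k (w : cube k) : boxHom k k :=
  bsel (fun j => if w j then inl (j, false) else inr false).

Lemma meetE k (w x : cube k) j : meet w x j = w j && x j.
Proof. by rewrite ffunE; case: (w j). Qed.

Lemma meetC k (v w : cube k) : meet v w = meet w v.
Proof. by apply/ffunP => j; rewrite !meetE andbC. Qed.

Lemma meetA k (u v w : cube k) : meet u (meet v w) = meet (meet u v) w.
Proof. by apply/ffunP => j; rewrite !meetE andbA. Qed.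

Lemma meetxx k (w : cube k) : meet w w = w.
Proof. by apply/ffunP => j; rewrite !meetE andbb. Qed.

Lemma meet_idl k (v w : cube k) : meet w (meet w v) = meet w v.
Proof. by rewrite meetA meetxx. Qed.

Lemma meet1 k (x : cube k) : meet (ones k) x = x.
Proof. by apply/ffunP => j; rewrite !meetE ffunE. Qed.

Lemma onesP k (x : cube k) : [forall j, x j] = (x == ones k).
Proof.
apply/forallP/eqP => [h|->] => [|j]; last by rewrite ffunE.
by apply/ffunP => j; rewrite ffunE h.
Qed.

Lemma neq_ones k (x : cube k) : x != ones k -> exists j, x j = false.
Proof.
by rewrite -onesP negb_forall => /existsP[j xj]; exists j; exact/negbTE.
Qed.

Definition wt k (w : cube k) : nat := #|[pred i | w i]|.

Lemma wt_meet k (v w : cube k) : wt (meet w v) <= wt w.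
Proof.
by apply/subset_leq_card/fintype.subsetP => i; rewrite !inE meetE => /andP[].
Qed.

Lemma wt_lt k (v w : cube k) : meet w v != w -> wt (meet w v) < wt w.
Proof.
move=> vw; apply/proper_card/properP; split.
  by apply/fintype.subsetP => i; rewrite !inE meetE => /andP[].
have [i wi] : exists i, meet w v i != w i.
  apply/existsP; rewrite -negb_forall; apply: contraNN vw => /forallP h.
  by apply/eqP/ffunP => j; exact/eqP.
by exists i; move: wi; rewrite !inE meetE; case: (w i) => //= /negbTE; case: (v i).
Qed.

(** Induction on the weight. Goodness at [w] depends only on the values below [w], so all vertices
    of one weight can be updated at once without disturbing each other or the lighter ones. *)
Lemma cube_build k T (good : (cube k -> T) -> cube k -> Prop) :
  (forall h h' w, (forall x, h (meet w x) = h' (meet w x)) -> good h w -> good h' w) ->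
  (forall h w, (forall v : cube k, v != w -> meet w v = v -> good h v) ->
     exists y, good (upd h w y) w) ->
  forall h : cube k -> T, exists g, forall w, good g w.
Proof.
move=> good_ext step h0.
have [g gP] : exists g, forall w : cube k, wt w < k.+1 -> good g w.
  elim: k.+1 => [|m [h hP]]; first by exists h0.
  have /choice[Y YP] : forall w : cube k, exists y, wt w = m -> good (upd h w y) w.
    move=> w; have [wm|] := pselect (wt w = m); last by exists (h0 w).
    have [|y hy] := step h w; last by exists y.
    move=> v vw wv; apply: hP; rewrite -wm -wv; apply: wt_lt.
    by rewrite wv.
  exists (fun x => if wt x == m then Y x else h x) => w; rewrite ltnS leq_eqVlt.
  case/orP => [/eqP wm|wm].
    apply: good_ext (YP w wm) => x; rewrite /upd; have [->|xw] := eqVneq.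
      by rewrite wm eqxx.
    by rewrite ifN// neq_ltn -wm wt_lt.
  apply: good_ext (hP w wm) => x; rewrite ifN// neq_ltn.
  by rewrite (leq_ltn_trans (wt_meet x w) wm).
exists g => w; apply: gP; rewrite ltnS /wt -[leqRHS]card_ord.
exact: max_card.
Qed.

Section Embed.
Variables (m k : nat) (s : 'I_m -> 'I_k) (sI : injective s) (b : cube k).

Definition emb : boxHom m k :=
  bsel (fun i => if [pick j | s j == i] is Some j then inl (j, false) else inr (b i)).

Lemma emb_in u j : emb u (s j) = u j.
Proof.
rewrite ffunE; case: pickP => [l /eqP/sI ->//|/(_ j)].
by rewrite eqxx.
Qed.

Lemma emb_out u i : (forall j, s j != i) -> emb u i = b i.
Proof.
move=> si; rewrite ffunE; case: pickP => [j sj|//].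
by move: (si j); rewrite sj.
Qed.

Lemma emb_spec u i : (exists2 j, s j = i & emb u i = u j) \/ emb u i = b i.
Proof.
have [[j <-]|h] := pselect (exists j, s j = i); first by left; exists j; rewrite ?emb_in.
by right; apply: emb_out => j; apply/eqP => e; apply: h; exists j.
Qed.

End Embed.

(** Leave free [m] of the coordinates at which [w] is 1 and fix the others as in [w]. Claims about
    the last vertex of an m-cube thus carry over to vertices of weight at least [m]. *)
Lemma emb_below m k (w : cube k) : m <= wt w ->
  exists f : boxHom m k, [/\ f (ones m) = w, forall u, meet w (f u) = f u
    & forall u : cube m, u != ones m -> f u != w].
Proof.
move=> mw; pose s (j : 'I_m) : 'I_k := enum_val (widen_ord mw j).
have sI : injective s by move=> i j /enum_val_inj/(congr1 val)/= /val_inj.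
have ws j : w (s j) by have := enum_valP (widen_ord mw j).
exists (emb s w); split.
- apply/ffunP => i; have [[j <- ->]|->//] := emb_spec sI w (ones m) i.
  by rewrite ffunE ws.
- move=> u; apply/ffunP => i; rewrite meetE.
  have [[j <- ->]|->] := emb_spec sI w u i; first by rewrite ws.
  by rewrite andbb.
move=> u /neq_ones[j uj]; apply/eqP => /(congr1 (fun x : cube k => x (s j))).
by rewrite emb_in// uj ws.
Qed.

(** The face {x <= w} is itself a cube, with parametrization [e] and retraction [r]; its last vertex
    is [w]. *)
Lemma emb_face k (w : cube k) :
  exists (e : boxHom (wt w) k) (r : boxHom k (wt w)),
    [/\ forall x, e (r x) = meet w x, forall u, r (e u) = u,
        forall u v, e (meet u v) = meet (e u) (e v) & e (ones _) = w].
Proof.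
pose s (j : 'I_(wt w)) : 'I_k := enum_val j.
have sI : injective s by exact: enum_val_inj.
pose b : cube k := [ffun => false].
have re u : bsel (fun j => inl (s j, false)) (emb s b u) = u.
  by apply/ffunP => j; rewrite ffunE /= emb_in.
have er x : emb s b (bsel (fun j => inl (s j, false)) x) = meet w x.
  apply/ffunP => i; rewrite meetE; have [wi|wi] := boolP (w i).
    have -> : i = s (enum_rank_in (A := [pred i | w i]) wi i).
      by rewrite /s enum_rankK_in.
    by rewrite emb_in// ffunE.
  rewrite emb_out ?ffunE// => j; apply: contraNN wi => /eqP <-.
  by have := enum_valP j.
exists (emb s b), (bsel (fun j => inl (s j, false))); split=> //.
  move=> u v; apply/ffunP => i; rewrite meetE.
  have [[j <-]|h] := pselect (exists j, s j = i); first by rewrite !emb_in// meetE.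
  by rewrite !emb_out ?ffunE// => j; apply/eqP => e; apply: h; exists j.
rewrite -[RHS]meetxx -er; congr (emb _ _ _); apply/ffunP => j; rewrite !ffunE /=.
by have /esym := enum_valP j.
Qed.

(** * Nilspaces, without ergodicity or a bound on the step *)

(** Cubes are recorded by their vertices only. A corner is a function on all of {0,1}^k that is a
    cube on {x <= v} for each v other than the last vertex; its value at the last vertex is a
    dummy. *)
Record nilspace := Nilspace {
  npt :> Type;
  iscube : forall k, (cube k -> npt) -> Prop;
  iscube0 : forall g : cube 0 -> npt, iscube g;
  iscube_pull : forall m k (f : boxHom m k) g, iscube g -> iscube (g \o f);
  iscube_fill : forall k (h : cube k -> npt), 0 < k ->
    (forall v : cube k, v != ones k -> iscube (h \o meet v)) ->
    exists y, iscube (upd h (ones k) y) }.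
Arguments iscube {n k} _ : rename.

Section Nilspace.
Variable T : nilspace.

Lemma iscube_pullE m k (f : boxHom m k) (g : cube k -> T) (h : cube m -> T) :
  iscube g -> (forall x, h x = g (f x)) -> iscube h.
Proof. by move=> gC hE; rewrite (_ : h = g \o f); [exact: iscube_pull|exact: funext]. Qed.

Lemma iscube_eq k (g h : cube k -> T) : iscube g -> (forall x, h x = g x) -> iscube h.
Proof. by move=> gC /funext ->. Qed.

Lemma iscube_cst k (x : T) : iscube (fun _ : cube k => x).
Proof. by apply: (iscube_pullE (f := box_term k) (iscube0 (fun=> x))). Qed.

Section FillAt.
Variable R : T -> T -> Prop.
Hypothesis fillR : forall m (h c : cube m -> T), iscube c ->
  (forall v : cube m, v != ones m -> R (h v) (c v)) ->
  (forall v : cube m, v != ones m -> iscube (h \o meet v)) ->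
  exists2 y, iscube (upd h (ones m) y) & R y (c (ones m)).

(** Filling at the last vertex is moved to [w] by [emb_face]. The relation [R] is later either
    trivial or [sim n]. *)
Lemma fill_at k (h c : cube k -> T) (w : cube k) : iscube c ->
  (forall v : cube k, v != w -> meet w v = v -> R (h v) (c v)) ->
  (forall v : cube k, v != w -> meet w v = v -> iscube (h \o meet v)) ->
  exists2 y, iscube (upd h w y \o meet w) & R y (c w).
Proof.
move=> cC hR hC; have [e [r [er re eM e1]]] := emb_face w.
have ew u : meet w (e u) = e u by rewrite -er re.
have rw : r w = ones _ by rewrite -[X in r X]e1 re.
have eN (u : cube _) : u != ones _ -> e u != w.
  by apply: contraNN => /eqP eu; rewrite -(re u) eu rw.
have [||y yC yR] := fillR (iscube_pull e cC) (h := h \o e).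
- by move=> u u1; apply: hR; [exact: eN|exact: ew].
- move=> u u1; apply: (iscube_pullE (f := e) (hC _ (eN _ u1) (ew _))) => x /=.
  by rewrite eM.
exists y; last by rewrite -e1.
apply: (iscube_pullE (f := r) yC) => x; rewrite /= /upd /= er; congr (if _ then _ else _).
apply/eqP/eqP => [wx|rx]; last by rewrite -[LHS]er rx e1.
by rewrite -[LHS]re er wx rw.
Qed.

(** Vertices are corrected by increasing weight, each with a filler close to the cube given below
    it. This is what lifts corners along quotient maps. *)
Lemma lift_cubes k (D : cube k -> Prop) (h : cube k -> T) :
  (forall v w, D w -> meet w v = v -> D v) ->
  (forall w, D w -> exists2 c : cube k -> T, iscube c &
     forall v, meet w v = v -> R (h v) (c v) /\ R (c v) (h v)) ->
  (forall x y z, R x y -> R y z -> R x z) ->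
  exists g : cube k -> T, forall w, D w -> iscube (g \o meet w) /\ R (g w) (h w).
Proof.
move=> Ddown hR Rt; pose good (g : cube k -> T) w := D w -> iscube (g \o meet w) /\ R (g w) (h w).
have [||g gP] := @cube_build k T good _ _ h; last by exists g.
  move=> g g' w gg' gw Dw; have [gC gR] := gw Dw; split.
    by apply: (iscube_eq gC) => x /=; rewrite gg'.
  by rewrite -(meetxx w) -gg' meetxx.
move=> g w IH; have [Dw|nDw] := pselect (D w); last by exists (h w).
have [c cC cR] := hR w Dw.
have [||y yC yR] := @fill_at k g c w cC.
- move=> v vw wv; have [_ gv] := IH v vw wv (Ddown _ _ Dw wv).
  by apply: Rt gv _; have [] := cR v wv.
- by move=> v vw wv; have [] := IH v vw wv (Ddown _ _ Dw wv).
exists y => _; split=> //; rewrite /upd eqxx; apply: Rt yR _.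
by have [] := cR w (meetxx w).
Qed.

End FillAt.

Lemma fill_any m (h c : cube m -> T) : iscube c ->
  (forall v : cube m, v != ones m -> True) ->
  (forall v : cube m, v != ones m -> iscube (h \o meet v)) ->
  exists2 y, iscube (upd h (ones m) y) & True.
Proof.
case: m h c => [|m] h c cC _ hC; first by exists (c (ones 0)) => //; exact: iscube0.
by have [y yC] := iscube_fill (ltn0Sn m) hC; exists y.
Qed.

(** Vertices outside [D] are filled by increasing weight; on [D] the function is already a cube
    below each vertex and is kept. *)
Lemma iscube_extend k (D : pred (cube k)) (h : cube k -> T) :
  (forall v w, D w -> meet w v = v -> D v) ->
  (forall w, D w -> iscube (h \o meet w)) ->
  exists2 g : cube k -> T, iscube g & forall w, D w -> g w = h w.
Proof.
move=> Ddown hC.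
pose good (g : cube k -> T) w := iscube (g \o meet w) /\ (D w -> g w = h w).
have [||g gP] := @cube_build k T good _ _ h.
- move=> g g' w gg' [gC gD]; split.
    by apply: (iscube_eq gC) => x /=; rewrite gg'.
  by rewrite -(meetxx w) -gg' meetxx.
- move=> g w IH; have [Dw|nDw] := boolP (D w).
    exists (h w); split; last by rewrite /upd eqxx.
    apply: (iscube_eq (hC w Dw)) => x; rewrite /= /upd.
    have [->//|xw] := eqVneq (meet w x) w.
    have [|_ ->//] := IH (meet w x) xw; first exact: meet_idl.
    by apply: Ddown Dw _; exact: meet_idl.
  have [||y yC _] := @fill_at (fun _ _ => True) fill_any k g _ w (iscube_cst k (h w)) => //.
    by move=> v vw wv; have [] := IH v vw wv.
  by exists y; split=> // Dw; rewrite Dw in nDw.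
exists g => [|w Dw]; last exact: (gP w).2.
by apply: (iscube_eq (gP (ones k)).1) => x /=; rewrite meet1.
Qed.

(** * Gluing cubes and replacing their values on upper faces *)

Definition setc k (i : 'I_k) b : boxHom k k :=
  bsel (fun j => if j == i then inr b else inl (j, false)).

Lemma setcE k (i : 'I_k) b (x : cube k) j : setc i b x j = if j == i then b else x j.
Proof. by rewrite ffunE; case: ifP. Qed.

Lemma setc_id k (i : 'I_k) b (x : cube k) : x i = b -> setc i b x = x.
Proof. by move=> xi; apply/ffunP => j; rewrite setcE; have [->|] := eqVneq j i. Qed.

(** With an extra coordinate t, put [c'] on t = 0, and on x_i = 0 put [c] with its coordinate i
    turned into 1 - t. This partial cube, undefined on t = x_i = 1, is completed and then restricted
    to t = 1 - x_i. *)
Lemma iscube_glue k (i : 'I_k) (c c' : cube k -> T) : iscube c -> iscube c' ->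
  (forall x, c (setc i true x) = c' (setc i false x)) ->
  iscube (fun x => if x i then c' x else c x).
Proof.
move=> cC c'C cc'; pose t : 'I_k.+1 := ord0.
pose tl := box_drop t.
pose D (w : cube k.+1) := ~~ (w t && w (lift t i)).
pose h (z : cube k.+1) := if z t then c (setc i false (tl z)) else c' (tl z).
have tlE z j : tl z j = z (lift t j) by rewrite ffunE.
have [||g gC gD] := @iscube_extend _ D h.
- move=> v w + wv; rewrite /D -wv !meetE.
  by case: (w t) => //=; case: (w (lift t i)) => //= _; rewrite andbF.
- move=> w Dw; have [wt0|wt0] := boolP (w t); last first.
    apply: (iscube_pullE (f := box_comp tl (meet w)) c'C) => z.
    by rewrite /h /= meetE (negbTE wt0).
  have wi : w (lift t i) = false by move: Dw; rewrite /D wt0 => /negbTE.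
  pose rho : boxHom k.+1 k := bsel (fun j => if j == i then inl (t, true)
    else if w (lift t j) then inl (lift t j, false) else inr false).
  apply: (iscube_pullE (f := rho) cC) => z; rewrite /h /=.
  rewrite meetE wt0 /=; case zt : (z t).
    congr (c _); apply/ffunP => j; rewrite setcE tlE meetE [RHS]ffunE.
    by case: eqP; rewrite ?zt//; case: (w _).
  rewrite -[tl _](@setc_id _ i false) ?tlE ?meetE ?wi// -cc'.
  congr (c _); apply/ffunP => j; rewrite setcE tlE meetE [RHS]ffunE.
  by case: eqP; rewrite ?zt//; case: (w _).
pose del : boxHom k k.+1 :=
  bsel (fun j => if unlift t j is Some j' then inl (j', false) else inl (i, true)).
have delt x : del x t = ~~ x i by rewrite ffunE unlift_none.
have dell x j : del x (lift t j) = x j by rewrite ffunE liftK.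
have tld x : tl (del x) = x by apply/ffunP => j; rewrite tlE dell.
apply: (iscube_pullE (f := del) gC) => x.
rewrite gD; last by rewrite /D delt dell; case: (x i).
rewrite /h delt tld; case xi : (x i) => //=.
by rewrite setc_id.
Qed.

Definition repl k (J : pred 'I_k) (g e : cube k -> T) (x : cube k) : T :=
  if [forall j, J j ==> x j] then e x else g x.

Definition set_ones k (A : pred 'I_k) : boxHom k k :=
  bsel (fun j => if A j then inr true else inl (j, false)).

Lemma set_onesE k (A : pred 'I_k) (x : cube k) j : set_ones A x j = A j || x j.
Proof. by rewrite ffunE; case: (A j). Qed.

(** The values of [e] occur only where x_i = 1. Gluing in direction [i] with [g \o set_ones A],
    reflected for one implication and not for the other, exchanges the half x_i = 0 and keeps the
    half x_i = 1. *)
Lemma iscube_repl_step k (J A : pred 'I_k) i (g e : cube k -> T) : J i ->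
  iscube g ->
  iscube (repl J (g \o set_ones A) e) <-> iscube (repl J (g \o set_ones [predU1 i & A]) e).
Proof.
move=> Ji gC.
have J0 (x : cube k) : x i = false -> [forall j, J j ==> x j] = false.
  by move=> xi; apply/forallP => /(_ i); rewrite Ji xi.
split=> rC.
- pose fl : boxHom k k := bsel (fun j => inl (j, j == i)).
  have glC := iscube_glue (i := i) (iscube_pull (box_comp (set_ones A) fl) gC) rC.
  apply: (iscube_eq (glC _)) => x.
    rewrite /repl J0 ?setcE ?eqxx//=; congr g; congr (set_ones A _).
    by apply/ffunP => j; rewrite setcE ffunE /= setcE; case: (j == i).
  rewrite /repl /=; case: (boolP (x i)) => xi.
    case: ifP => // _; congr g; apply/ffunP => j; rewrite !set_onesE inE /=.
    by have [->|_] := eqVneq j i; rewrite //= xi orbT.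
  rewrite J0; last exact/negbTE.
  congr g; apply/ffunP => j; rewrite -[LHS]/(set_ones _ x j) -[RHS]/(set_ones _ (fl x) j).
  rewrite !set_onesE /= ffunE /=.
  by have [->|_] := eqVneq j i; rewrite //= (negbTE xi) orbT.
have glC := iscube_glue (i := i) (iscube_pull (set_ones A) gC) rC.
apply: (iscube_eq (glC _)) => x.
  rewrite /repl J0 ?setcE ?eqxx//=; congr g; apply/ffunP => j.
  by rewrite !set_onesE !setcE /=; have [->|_] := eqVneq j i; rewrite ?orbT.
rewrite /repl /=; case: (boolP (x i)) => xi.
  case: ifP => // _; congr g; apply/ffunP => j; rewrite !set_onesE /=.
  by have [->|_] := eqVneq j i; rewrite //= xi orbT.
by rewrite J0//; exact/negbTE.
Qed.

(** Whether [e] may replace [g] on the upper face given by [J] depends only on [g] on that face: the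
    right-hand side spreads these values constantly along [J]. Vertex replacement and the calculus
    of parallel pairs rest on this. *)
Lemma iscube_repl k (J : pred 'I_k) (g e : cube k -> T) : iscube g ->
  iscube (repl J g e) <-> iscube (repl J (g \o set_ones J) e).
Proof.
move=> gC.
suff key (s : seq 'I_k) : all J s ->
    iscube (repl J g e) <-> iscube (repl J (g \o set_ones (mem s)) e).
  have [|kl kr] := key (enum J); first by apply/allP => j; rewrite mem_enum.
  suff <- : set_ones (mem (enum J)) = set_ones J by [].
  apply: boxHom_ext => x; apply/ffunP => j.
  by rewrite !set_onesE -[mem _ j]/(j \in enum J) mem_enum.
elim: s => [_|i s IH /= /andP[Ji Js]].
  suff -> : g \o set_ones (mem [::]) = g by [].
  by apply: funext => x; rewrite /=; congr g; apply/ffunP => j; rewrite set_onesE.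
have [l r] := IH Js.
have [l' r'] := @iscube_repl_step _ _ (mem s) _ _ e Ji gC.
suff -> : set_ones (mem (i :: s)) = set_ones [predU1 i & mem s] by split=> [/l/l'|/r'/r].
by apply: boxHom_ext => x; apply/ffunP => j; rewrite !set_onesE.
Qed.

(* This is the relation ~_(m-1) of nilspace theory. *)
Definition sim m (x y : T) : Prop := iscube (upd (fun=> x) (ones m) y).

Lemma sim_repl k (g : cube k -> T) y : iscube g ->
  iscube (upd g (ones k) y) <-> sim k (g (ones k)) y.
Proof.
move=> gC; have := iscube_repl xpredT (fun=> y) gC.
have rE (h : cube k -> T) : repl xpredT h (fun=> y) = upd h (ones k) y.
  apply: funext => x; rewrite /repl /upd -onesP; congr (if _ then _ else _).
suff -> : g \o set_ones xpredT = fun=> g (ones k) by rewrite !rE.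
by apply: funext => x; rewrite /=; congr g; apply/ffunP => j; rewrite set_onesE ffunE.
Qed.

Lemma sim_refl m x : sim m x x.
Proof. by apply: (iscube_eq (iscube_cst m x)) => u; rewrite /upd; case: ifP. Qed.

Lemma sim_le k m x y : k <= m -> sim m x y -> sim k x y.
Proof.
move=> km xy; pose f : boxHom k m :=
  bsel (fun j => if insub (val j) is Some i then inl (i, false) else inr true).
apply: (iscube_pullE (f := f) xy) => u; rewrite /upd -!onesP; congr (if _ then _ else _).
apply/forallP/forallP => h j.
  by rewrite ffunE; case: insub.
have := h (widen_ord km j); rewrite ffunE (insubT (fun i => i < k) (ltn_ord j)) /=.
by rewrite (_ : Sub _ _ = j)//; exact: val_inj.
Qed.

Lemma iscube_upd k m (g : cube k -> T) w y : k <= m -> iscube g -> sim m (g w) y ->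
  iscube (upd g w y).
Proof.
(* The reflection [r] exchanges [w] with the last vertex, where [sim_repl] applies. *)
move=> km gC /(sim_le km) wy; pose r : boxHom k k := bsel (fun j => inl (j, ~~ w j)).
have rK x : r (r x) = x by apply/ffunP => j; rewrite !ffunE /= addKb.
have r1 : r (ones k) = w by apply/ffunP => j; rewrite !ffunE /= addbT negbK.
have grC := iscube_pull r gC.
rewrite -r1 in wy; have /(iscube_pull r) := (sim_repl y grC).2 wy.
move/iscube_eq; apply => x /=; rewrite /upd /= rK; congr (if _ then _ else _).
apply/eqP/eqP => [->|rx]; first by rewrite -[X in r X]r1 rK.
by rewrite -[RHS]r1 -rx rK.
Qed.

(** Vertices are replaced one after another; the list [s] holds those already done. *)
Lemma iscube_sim k m (g h : cube k -> T) : k <= m -> iscube g ->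
  (forall v, sim m (g v) (h v)) -> iscube h.
Proof.
move=> km gC gh.
suff key (s : seq (cube k)) : iscube (fun x => if x \in s then h x else g x).
  by apply: (iscube_eq (key (enum {: cube k}))) => x; rewrite mem_enum.
elim: s => [//|v s IH].
have [vs|vs] := boolP (v \in s).
  by apply: (iscube_eq IH) => x; rewrite inE; have [->|] := eqVneq x v; rewrite ?vs.
have := iscube_upd (w := v) (y := h v) km IH; rewrite (negbTE vs) => /(_ (gh v)).
move/iscube_eq; apply => x; rewrite /upd inE.
by have [->|] := eqVneq x v.
Qed.

Lemma sim_sym m x y : sim m x y -> sim m y x.
Proof.
move=> xy; apply: (iscube_sim (leqnn m) (iscube_cst m x)) => v.
by rewrite /upd; case: ifP => // _; exact: sim_refl.
Qed.

Lemma sim_trans m x y z : sim m x y -> sim m y z -> sim m x z.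
Proof.
move=> xy yz; apply: (iscube_sim (leqnn m) xy) => v.
by rewrite /upd; case: ifP => // _; exact: sim_refl.
Qed.

(** Replacing the vertices of [h] other than the last by those of [g] leaves a cube, which differs
    from [g] only at the last vertex. *)
Lemma sim_uniq1 m (g h : cube m -> T) : iscube g -> iscube h ->
  (forall v, v != ones m -> sim m (g v) (h v)) -> sim m (g (ones m)) (h (ones m)).
Proof.
move=> gC hC gh; apply/(sim_repl _ gC); apply: (iscube_sim (leqnn m) hC) => v.
rewrite /upd; have [->|vm] := eqVneq v (ones m); first exact: sim_refl.
exact/sim_sym/gh.
Qed.

Lemma sim_uniq k m (g h : cube k -> T) (w : cube k) : m <= wt w ->
  iscube (g \o meet w) -> iscube (h \o meet w) ->
  (forall v : cube k, v != w -> meet w v = v -> sim m (g v) (h v)) ->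
  sim m (g w) (h w).
Proof.
move=> mw gC hC gh; have [f [f1 fw fN]] := emb_below mw.
rewrite -f1 -[g _]/((g \o f) (ones m)) -[h _]/((h \o f) (ones m)).
apply: sim_uniq1.
- by apply: (iscube_pullE (f := f) gC) => x; rewrite /= fw.
- by apply: (iscube_pullE (f := f) hC) => x; rewrite /= fw.
- by move=> v v1; apply: gh; [exact: fN|exact: fw].
Qed.

Lemma wt_ones k : wt (ones k) = k.
Proof. by rewrite -[RHS]card_ord; apply: eq_card => i; rewrite !inE ffunE. Qed.

(** In dimension at most [n] the last vertex of [c] completes the corner, by vertex replacement;
    above [n] any filler is equivalent to it, by uniqueness. *)
Lemma fill_sim n m (h c : cube m -> T) : iscube c ->
  (forall v : cube m, v != ones m -> sim n (h v) (c v)) ->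
  (forall v : cube m, v != ones m -> iscube (h \o meet v)) ->
  exists2 y, iscube (upd h (ones m) y) & sim n y (c (ones m)).
Proof.
move=> cC hc hC; have [mn|nm] := leqP m n.
  exists (c (ones m)); last exact: sim_refl.
  apply: (iscube_sim mn cC) => v; rewrite /upd; case: eqVneq => [->|v1]; first exact: sim_refl.
  exact/sim_sym/hc.
have [y yC _] := fill_any cC (fun _ _ => I) hC; exists y => //.
have -> : y = upd h (ones m) y (ones m) by rewrite /upd eqxx.
apply: sim_uniq; rewrite ?wt_ones; first exact: ltnW.
- by apply: (iscube_eq yC) => x /=; rewrite meet1.
- by apply: (iscube_eq cC) => x /=; rewrite meet1.
- by move=> v v1 _; rewrite /upd (negbTE v1); exact: hc.
Qed.

End Nilspace.

(** * Parallel pairs and translations in an ergodic nilspace of finite step *)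

Section NStep.
Variables (T : nilspace) (N : nat).
Hypothesis step : forall x y : T, sim N.+1 x y -> x = y.
Hypothesis erg : forall x y : T, sim 1 x y.

Let t : 'I_N.+1 := ord0.
Let tl : boxHom N.+1 N := box_drop t.

Definition edge_fun (x y : T) (v : cube N.+1) : T := if v t then y else x.

Definition nonfirst : pred 'I_N.+1 := fun j => j != t.

Lemma nonfirstP (v : cube N.+1) :
  [forall j, nonfirst j ==> v j] = (tl v == ones N).
Proof.
rewrite -onesP; apply/forallP/forallP => h j.
  by rewrite ffunE; have := h (lift t j); rewrite /nonfirst eq_sym neq_lift.
apply/implyP; rewrite /nonfirst => jt.
have tj : t != j by rewrite eq_sym.
have [l jl _] := unlift_some tj.
by have := h l; rewrite ffunE -jl.
Qed.

(* The (N+1)-cube consisting of two parallel N-cubes, the first one with value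
   x' at its last vertex and x elsewhere, the second one with y' and y. *)
Definition par (x x' y y' : T) : Prop :=
  iscube (repl nonfirst (edge_fun x y) (edge_fun x' y')).

(** Ergodicity enters here: any two points span an edge, which is spread along the other
    coordinates. *)
Lemma edge_cube x y : iscube (edge_fun x y).
Proof.
pose f : boxHom N.+1 1 := bsel (fun=> inl (t, false)).
apply: (iscube_pullE (f := f) (erg x y)) => v; rewrite /edge_fun /upd -onesP.
congr (if _ then _ else _); apply/esym/forallP; case vt: (v t); last first.
  by move=> /(_ ord0); rewrite ffunE /= vt.
by move=> j; rewrite ffunE.
Qed.

Lemma par_refl x y : par x x y y.
Proof. by apply: (iscube_eq (edge_cube x y)) => v; rewrite /repl; case: ifP. Qed.

Lemma par_sim x x' y y' : par x x' y y' -> sim N x x'.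
Proof.
move=> P; apply: (iscube_pullE (f := eps t) P) => v.
rewrite /repl nonfirstP /edge_fun eps_at /upd; congr (if _ then _ else _).
congr (_ == _); apply/ffunP => j; rewrite !ffunE; case: unliftP => [l /lift_inj ->//|].
by move/eqP; rewrite eq_sym (negbTE (neq_lift _ _)).
Qed.

Lemma par_flip x x' y y' : par x x' y y' -> par y y' x x'.
Proof.
move=> P; pose f : boxHom N.+1 N.+1 := bsel (fun j => inl (j, j == t)).
have ft v : f v t = ~~ v t by rewrite ffunE /= ?eqxx.
apply: (iscube_pullE (f := f) P) => v; rewrite /repl /edge_fun ft.
rewrite (_ : [forall j, nonfirst j ==> f v j] = [forall j, nonfirst j ==> v j]).
  by case: (v t).
by apply: eq_forallb => j; rewrite ffunE /= /nonfirst; case: (j == t).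
Qed.

Lemma par_htrans x x' y y' z z' : par x x' y y' -> par y y' z z' -> par x x' z z'.
Proof.
move=> P Q; apply: (iscube_eq (iscube_glue (i := t) P Q _)) => v; last first.
  by rewrite /repl /edge_fun; case: (v t).
rewrite /repl /edge_fun !setcE eqxx; congr (if _ then _ else _).
by apply: eq_forallb => j; rewrite !setcE /nonfirst; case: (j == t).
Qed.

(** By [iscube_repl], whether (x'', y'') may replace the upper edge (x', y') of the first cube
    depends on that edge alone, and the second hypothesis says that it may. *)
Lemma par_vtrans x x' x'' y y' y'' :
  par x x' y y' -> par x' x'' y' y'' -> par x x'' y y''.
Proof.
move=> P Q; have [_ h] := iscube_repl nonfirst (edge_fun x'' y'') P.
apply: (iscube_eq (h _)) => [|v]; last by rewrite /repl; case: ifP.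
apply: (iscube_eq Q) => v; rewrite /repl; case: ifP => //= _.
rewrite ifT; last by apply/forallP => j; rewrite set_onesE; case: nonfirst.
by rewrite /edge_fun set_onesE.
Qed.

(** The point [y'] fills a corner: on t = 0 it is the cube witnessing [sim N x x'], and its other
    lower faces miss the edge from x' to y', so that they come from [edge_cube]. *)
Lemma par_ex x x' y : sim N x x' -> exists y', par x x' y y'.
Proof.
move=> xx'; have [v v1|z zC] := @iscube_fill T _ (repl nonfirst (edge_fun x y) (edge_fun x' x)) (ltn0Sn N).
  case vt : (v t).
    apply: (iscube_pullE (f := meet v) (edge_cube x y)) => u /=.
    rewrite /repl ifF// nonfirstP -nonfirstP; apply/forallP => h.
    move: v1; rewrite -onesP => /forallP; apply=> j.
    have [->//|jt] := eqVneq j t.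
    by have := h j; rewrite meetE /nonfirst jt => /andP[].
  apply: (iscube_pullE (f := box_comp tl (meet v)) xx') => u.
  by rewrite /= /repl /edge_fun nonfirstP meetE vt.
exists z; apply: (iscube_eq zC) => v; rewrite /repl /upd /edge_fun -onesP.
case: ifPn => h; case: (boolP (v t)) => vt.
- by rewrite ifT//; apply/forallP => j; have [->//|jt] := eqVneq j t; have := forallP h j; rewrite /nonfirst jt.
- by rewrite ifF//; apply/forallP => /(_ t); exact/negP.
- by rewrite ifF//; apply: contraNF h => /forallP h; apply/forallP => j; rewrite h implybT.
- by rewrite ifF//; apply/forallP => /(_ t); exact/negP.
Qed.

Lemma par_uniq x x' y y' z : par x x' y y' -> par x x' y z -> y' = z.
Proof.
move=> P Q; apply: step; apply/sim_sym.
have := (sim_repl y' Q).1; rewrite {2}/repl ifT; last first.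
  by apply/forallP => j; rewrite ffunE implybT.
rewrite /edge_fun ffunE; apply; apply: (iscube_eq P) => v; rewrite /upd /repl /edge_fun.
have [->|v1] := eqVneq v (ones _); first by rewrite ifT ?ffunE//; apply/forallP => j; rewrite ffunE implybT.
case: ifPn => // h; case: ifPn => // vt.
case/eqP: v1; apply/ffunP => j; rewrite ffunE.
by have [->//|jt] := eqVneq j t; have := forallP h j; rewrite /nonfirst jt.
Qed.

Lemma par_edge (c : cube N.+1 -> T) i (v : cube N.+1) z0 z1 : iscube c ->
  par (c (setc i false v)) z0 (c (setc i true v)) z1 ->
  iscube (fun x => if setc i true x == setc i true v
                   then (if x i then z1 else z0) else c x).
Proof.
move=> cC P.
(* A symmetry carrying the upper edge in direction [t] to the edge in direction [i] through [v], so
   that [iscube_repl] applies; [s'] is a right inverse. *)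
pose s : boxHom N.+1 N.+1 :=
  bsel (fun j => inl (tperm t i j, if j == i then false else ~~ v j)).
pose s' : boxHom N.+1 N.+1 :=
  bsel (fun j => inl (tperm t i j, if tperm t i j == i then false else ~~ v (tperm t i j))).
have sK x : s (s' x) = x.
  by apply/ffunP => j; rewrite !ffunE /= tpermK addKb.
have [_ h] := iscube_repl nonfirst (edge_fun z0 z1) (iscube_pull s cC).
have {}h : iscube (repl nonfirst (c \o s) (edge_fun z0 z1)).
  apply: h; apply: (iscube_eq P) => x; rewrite /repl; case: ifP => //= _.
  rewrite /edge_fun.
  have -> : s (set_ones nonfirst x) = setc i (x t) v; last by case: (x t).
  apply/ffunP => j; rewrite ffunE /= set_onesE setcE.
  have [->|ji] := eqVneq j i; first by rewrite tpermR.
  rewrite (_ : nonfirst _) ?addbT ?negbK//.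
  by rewrite /nonfirst -(inj_eq (@perm_inj _ (tperm t i))) tpermK tpermL.
have s't x : s' x t = x i by rewrite ffunE /= tpermL eqxx.
apply: (iscube_pullE (f := s') h) => x; rewrite /repl /= sK /edge_fun s't.
congr (if _ then _ else _); apply/eqP/forallP => [xv j|h1].
  apply/implyP; rewrite /nonfirst => jt; rewrite ffunE /=.
  have ji : tperm t i j != i by rewrite -[i in X in _ != X](tpermL t) (inj_eq perm_inj).
  have := congr1 (fun u : cube _ => u (tperm t i j)) xv.
  by rewrite /= !setcE (negbTE ji) => ->; case: (v _).
apply/ffunP => j; rewrite !setcE; have [//|ji] := eqVneq j i.
have := h1 (tperm t i j); rewrite ffunE /= tpermK (negbTE ji).
rewrite /nonfirst -(inj_eq (@perm_inj _ (tperm t i))) tpermK tpermL ji /=.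
by case: (v j); case: (x j).
Qed.

(** Faces of dimension at most N+1 are retracts of the (N+1)-cube. For heavier [w], a filler at [w]
    has the prescribed value: compare both on an (N+1)-face with last vertex [w]. *)
Lemma cube_by_faces k (h : cube k -> T) :
  (forall f : boxHom N.+1 k, iscube (h \o f)) -> iscube h.
Proof.
move=> hf; suff key w : iscube (h \o meet w).
  by apply: (iscube_eq (key (ones k))) => x /=; rewrite meet1.
have [m] := ubnP (wt w); elim: m w => // m IH w /ltnSE wm.
have [wN|Nw] := leqP (wt w) N.+1.
  have [e [r [er _ _ _]]] := emb_face w.
  pose a : boxHom N.+1 (wt w) := bsel (fun j => inl (widen_ord wN j, false)).
  pose b : boxHom (wt w) N.+1 :=
    bsel (fun j => if insub (val j) is Some i then inl (i, false) else inr false).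
  have ab u : a (b u) = u.
    apply/ffunP => j; rewrite !ffunE /= (insubT (fun i => i < wt w) (ltn_ord j)) /=.
    by congr (u _); exact: val_inj.
  apply: (iscube_pullE (f := box_comp b r) (hf (box_comp e a))) => x.
  by rewrite /= -er -[in LHS](ab (r x)).
have [||y yC _] := @fill_at T (fun _ _ => True) (@fill_any T) k h _ w (iscube_cst k (h w)).
- by [].
- move=> v vw wv; apply: IH; apply: leq_trans wm.
  by rewrite -wv wt_lt// wv.
have [f [f1 fw fN]] := emb_below (ltnW Nw).
have yh : sim N.+1 ((upd h w y \o f) (ones _)) ((h \o f) (ones _)).
  apply: sim_uniq1 (hf f) _.
    by apply: (iscube_pullE (f := f) yC) => u; rewrite /= fw.
  by move=> v v1; rewrite /upd /= (negbTE (fN v v1)); exact: sim_refl.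
move: yh; rewrite /= f1 /upd eqxx => /step yh.
by apply: (iscube_eq yC) => x; rewrite /= /upd; case: eqP => // ->.
Qed.

(** * The action of D_N on cubes *)

Section Action.
Local Open Scope ring_scope.
Variables (A : zmodType) (val : A -> T) (act : A -> T -> T).
Hypothesis act0 : forall y, act 0 y = y.
Hypothesis actD : forall a b y, act (a + b) y = act a (act b y).
Hypothesis actP : forall a y, par (val 0) (val a) y (act a y).

Definition D_preserves k (f : {ffun cube k -> A}) : Prop :=
  forall c : cube k -> T, iscube c -> iscube (fun x => act (f x) (c x)).

(** The pairs (y, a.y) at the two ends of the edge are both parallel to ([val 0], [val a]), hence to
    each other, and [par_edge] applies. If v_i = 0 the function vanishes. *)
Lemma D_edge i (v : cube N.+1) a :
  D_preserves [ffun x => if setc i true x == v then a else 0].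
Proof.
move=> c cC; have [vi|vi] := boolP (v i); last first.
  apply: (iscube_eq cC) => x; rewrite ffunE ifN ?act0//; apply: contraNN vi => /eqP <-.
  by rewrite setcE eqxx.
have P : par (c (setc i false v)) (act a (c (setc i false v)))
             (c (setc i true v)) (act a (c (setc i true v))).
  exact: par_htrans (par_flip (actP _ _)) (actP _ _).
apply: (iscube_eq (par_edge cC P)) => x; rewrite ffunE (setc_id vi).
case: eqP => [<-|_]; last by rewrite act0.
case: ifPn => xi; congr (act _ (c _)); apply/ffunP => j; rewrite !setcE.
  by have [->|//] := eqVneq j i.
by have [->|//] := eqVneq j i; exact/negbTE.
Qed.

(** The condition on [- f] is what gives closure under differences. *)
Lemma D_preservesP k : is_subgroup
  [set f : {ffun cube k -> A} | D_preserves f /\ D_preserves (- f)].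
Proof.
split=> /= [|f g [f1 f2] [g1 g2]].
  by rewrite oppr0; split=> c cC; apply: (iscube_eq cC) => x; rewrite ffunE act0.
split=> c cC.
  by apply: (iscube_eq (f1 _ (g2 _ cC))) => x; rewrite !ffunE actD.
by apply: (iscube_eq (g1 _ (f2 _ cC))) => x; rewrite -actD !ffunE opprB.
Qed.

Lemma is_subgroup_sum (V : zmodType) (H : set V) (I : Type) (r : seq I) (P : pred I) F :
  is_subgroup H -> (forall i, P i -> H (F i)) -> H (\sum_(i <- r | P i) F i).
Proof.
move=> [H0 HB] HF; apply: (big_ind H) => // x y Hx Hy.
by rewrite -[y]opprK; apply: (HB) => //; rewrite -[- y]add0r; exact: HB.
Qed.

Lemma D_preserves_step (f : {ffun cube N.+1 -> A}) : D_sub N f -> D_preserves f.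
Proof.
move=> fD; suff [] : D_preserves f /\ D_preserves (- f) by [].
apply: (D_sub_ind (D_preservesP N.+1) _ fD) => _ [a [p [pN ->]]].
(* The dimension is at least (N+1) - N = 1, so there is a free direction [i], along which the face
   splits into edges; in the sum below, vertices with v_i = 0 contribute nothing. *)
have /card_gt0P[i] : (0 < face_dim p)%N by apply: leq_trans pN; rewrite subSnn.
rewrite inE => /eqP pi.
have -> : [ffun x => if face p x then a else 0] =
    \sum_(v : cube N.+1 | face p v) [ffun x => if setc i true x == v then a else 0].
  apply/ffunP => x; rewrite sum_ffunE ffunE.
  under eq_bigr do rewrite ffunE.
  have fx : face p (setc i true x) = face p x.
    apply: eq_forallb => j; rewrite setcE.
    by have [->|//] := eqVneq j i; rewrite pi.
  case: ifPn => px.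
    rewrite (bigD1 (setc i true x)) ?fx//= eqxx big1 ?addr0// => v /andP[_ vx].
    by rewrite eq_sym (negbTE vx).
  rewrite big1// => v pv; case: eqP => // xv; move: px.
  by rewrite -fx xv pv.
apply: (is_subgroup_sum _ (D_preservesP N.+1)) => v _; split; first exact: D_edge.
move=> c cC; apply: (iscube_eq (@D_edge i v (- a) c cC)) => x.
by rewrite !ffunE; case: ifP; rewrite ?oppr0.
Qed.

Lemma D_act_cube k (f : {ffun cube k -> A}) (c : cube k -> T) : D_sub N f -> iscube c ->
  iscube (fun x => act (f x) (c x)).
Proof.
move=> fD cC; apply: cube_by_faces => g.
have h := D_preserves_step (D_sub_pull g fD) (iscube_pull g cC).
by apply: (iscube_eq h) => x; rewrite ffunE.
Qed.

Hypothesis act_tr : forall y z, sim N y z -> exists a, act a y = z.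

Lemma act_sim a y : sim N y (act a y).
Proof. exact: par_sim (par_flip (actP a y)). Qed.

(* The difference is built up from the upper faces {x >= v} with |v| <= N; the
   remaining vertices agree since T is N-step. *)
Lemma D_act_tr k (c c' : cube k -> T) : iscube c -> iscube c' ->
  (forall x, sim N (c x) (c' x)) ->
  exists2 f : {ffun cube k -> A}, D_sub N f & forall x, act (f x) (c x) = c' x.
Proof.
move=> cC c'C cc'.
have [f fD fP] : exists2 f : {ffun cube k -> A}, D_sub N f &
    forall x, (wt x < N.+1)%N -> act (f x) (c x) = c' x.
  elim: {-2}N.+1 (leqnn N.+1) => [_|m IH mN].
    by exists 0 => //; have [] := D_sub_subgroup N A k.
  have [f fD fP] := IH (ltnW mN).
  have /choice[a aP] x : exists a, act a (act (f x) (c x)) = c' x.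
    by apply: act_tr; apply: sim_trans (cc' x); exact/sim_sym/act_sim.
  pose F v : {ffun cube k -> A} := [ffun x => if meet v x == v then a v else 0].
  exists (\sum_(v : cube k | wt v == m) F v + f).
    have [_ DB] := D_sub_subgroup N A k.
    rewrite -[f]opprK; apply: (DB); last first.
      by rewrite -[- f]add0r; apply: DB => //; have [] := D_sub_subgroup N A k.
    apply: is_subgroup_sum; first exact: D_sub_subgroup.
    move=> v /eqP vm; apply: D_sub_gen.
    (* The upper face {x >= v} has dimension k - m, and m <= N. *)
    exists (a v), [ffun i => if v i then Some true else None]; split.
      rewrite leq_subLR -[X in (X <= _)%N]card_ord -(cardC [pred i | v i]).
      apply: leq_add; first by rewrite -/(wt v) vm.
      apply/subset_leq_card/fintype.subsetP => i; rewrite !inE ffunE.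
      by case: (v i).
    apply/ffunP => x; rewrite !ffunE; congr (if _ then _ else _).
    apply/eqP/forallP => [vx i|h].
      rewrite ffunE; have := congr1 (fun u : cube _ => u i) vx.
      by rewrite meetE; case: (v i) => //= ->.
    apply/ffunP => i; rewrite meetE; have := h i; rewrite ffunE.
    by case: (v i) => //= /eqP[<-].
  move=> x; rewrite ltnS leq_eqVlt => xm; rewrite ffunE sum_ffunE actD.
  under eq_bigr do rewrite ffunE.
  case/orP: xm => [xm|xm].
    rewrite (bigD1 x) //= meetxx eqxx big1 ?addr0// => v /andP[/eqP vm vx].
    rewrite ifF//; apply/eqP => e; have := wt_lt (w := x) (v := v).
    rewrite meetC e vm (eqP xm) ltnn => h.
    by have := h vx.
  rewrite big1 ?act0 ?fP// => v /eqP vm; rewrite ifF//; apply/eqP => e.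
  by have := wt_meet v x; rewrite meetC e vm leqNgt xm.
exists f => // x.
have [m] := ubnP (wt x); elim: m x => // m IH x /ltnSE xm.
have [xN|Nx] := ltnP (wt x) N.+1; first exact: fP.
apply: step; have fC := D_act_cube fD cC.
apply: (sim_uniq Nx (iscube_pull _ fC) (iscube_pull _ c'C)) => v vx xv.
rewrite IH; first exact: sim_refl.
by apply: leq_trans xm; rewrite -xv wt_lt// xv.
Qed.

End Action.
End NStep.

(** * The quotient by ~_n is tau_n *)

Definition vert (X : cubeset) k (c : X k) (v : cube k) : X 0 := pull (vertex v) c.

Lemma vert_pull (X : cubeset) m k (f : boxHom m k) (c : X k) v :
  vert (pull f c) v = vert c (f v).
Proof. by rewrite /vert -pull_comp; congr pull; exact: boxHom_ext. Qed.

Lemma vert0 (X : cubeset) (c : X 0) v : vert c v = c.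
Proof. by rewrite /vert (box_term_uniq (vertex v) (box_id 0)) pull_id. Qed.

Lemma vert_map (X Y : cubeset) (f : cmap X Y) k (c : X k) v : vert (f k c) v = f 0 (vert c v).
Proof. by rewrite /vert cmap_pull. Qed.

Lemma in_corner0 m k (f : boxHom m k) i : (forall x, f x i = false) -> in_corner f.
Proof. by move=> fi; exists i, (box_comp (box_drop i) f); exact: eps_drop. Qed.

Lemma corner_neq k m (f : corner k m) x : sval f x != ones k.
Proof.
have [i fi] := in_corner_zero f; apply/eqP => /(congr1 (fun u : cube k => u i)).
by rewrite fi ffunE.
Qed.

Lemma meet_corner k (w : cube k) : w != ones k -> in_corner (meet w).
Proof. by move=> /neq_ones[i wi]; apply: (@in_corner0 _ _ _ i) => x; rewrite meetE wi. Qed.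

Lemma vertex_corner k (w : cube k) : w != ones k -> in_corner (vertex w).
Proof. by move=> /neq_ones[i wi]; apply: (@in_corner0 _ _ _ i) => x. Qed.

Definition cconcrete (X : cubeset) : Prop :=
  forall k, injective (fun (c : X k) (v : cube k) => vert c v).

Definition cfibrant (X : cubeset) : Prop :=
  forall k, 0 < k -> forall h : cmap (corner k) X, exists x : X k, corner_restr x = h.

Lemma vert_inj (X : cubeset) : cconcrete X -> forall k (c d : X k), (forall v, vert c v = vert d v) -> c = d.
Proof. by move=> cX k c d cd; apply: cX; exact: funext. Qed.

Lemma corner_vals (X : cubeset) k (H : cmap (corner k) X) : 0 < k ->
  exists h : cube k -> X 0, forall m (f : corner k m) v, vert (H m f) v = h (sval f v).
Proof.
case: k H => // k H _.
(* In positive dimension the origin lies in the corner; its value serves as the default at the last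
   vertex. *)
have z1 : [ffun => false] != ones k.+1.
  by apply/eqP => /(congr1 (fun u : cube k.+1 => u ord0)); rewrite !ffunE.
exists (fun v => match pselect (in_corner (vertex v)) with
  | left p => H 0 (exist _ _ p)
  | right _ => H 0 (exist _ _ (vertex_corner z1)) end) => m f v.
case: pselect => [p|]; last by have := vertex_corner (corner_neq f v).
rewrite /vert -cmap_pull; congr (H 0 _); apply: sig_ext.
exact: boxHom_ext.
Qed.

(** Each map into the corner factors through a facet x_i = 0, on which a cube is given; concreteness
    makes the chosen cubes compatible. *)
Lemma corner_map (X : cubeset) k (h : cube k -> X 0) : cconcrete X ->
  (forall v : cube k, v != ones k -> exists c : X k, vert c = h \o meet v) ->
  exists H : cmap (corner k) X, forall m (f : corner k m) v, vert (H m f) v = h (sval f v).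
Proof.
move=> cX hC.
have ex m (f : corner k m) : exists c : X m, forall v, vert c v = h (sval f v).
  have [i fi] := in_corner_zero f.
  have [|c cE] := hC [ffun j => j != i].
    by apply/eqP => /(congr1 (fun u : cube k => u i)); rewrite !ffunE eqxx.
  exists (pull (sval f) c) => v; rewrite vert_pull cE /=; congr h.
  apply/ffunP => j; rewrite meetE ffunE; have [->|//] := eqVneq j i.
  by rewrite fi.
have HP m p (g : boxHom p m) (f : corner k m) :
    sval (cid (ex p (pull g f))) = pull g (sval (cid (ex m f))).
  case: (cid (ex m f)) => c cE; case: cid => d dE /=.
  by apply: (vert_inj cX) => v; rewrite dE vert_pull cE.
by exists (@Cmap (corner k) X (fun m f => sval (cid (ex m f))) (fun p m => @HP m p)) => m f v /=; case: cid.
Qed.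

Section NilOf.
Variables (X : cubeset) (cX : cconcrete X) (fX : cfibrant X).

Program Definition nil_of : nilspace :=
  @Nilspace (X 0) (fun k g => exists c : X k, vert c = g) _ _ _.
Next Obligation.
move=> g; exists (g (ones 0)); apply: funext => v; rewrite vert0; congr g.
by apply/ffunP => -[].
Qed.
Next Obligation.
by move=> m k f _ [c <-]; exists (pull f c); apply: funext => v; rewrite vert_pull.
Qed.
Next Obligation.
move=> k h k0 hC; have [H HE] := corner_map cX hC.
have [c cH] := fX k0 H; exists (vert c (ones k)), c; apply: funext => v.
rewrite /upd; case: (eqVneq v (ones k)) => [->//|v1].
have := congr1 (fun u : cmap (corner k) _ => u 0 (exist _ _ (vertex_corner v1))) cH.
by rewrite /= -/(vert c v) => ->; rewrite -[LHS](vert0 _ (ones 0)) HE.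
Qed.

Lemma iscube_vert k (c : X k) : iscube (n := nil_of) (vert c).
Proof. by exists c. Qed.

Definition csim m (x y : X 0) : Prop := @sim nil_of m x y.

Definition ceqv m k (c d : X k) : Prop := forall v, csim m (vert c v) (vert d v).

Section Quot.
Variables (Q : cubeset) (m : nat) (q : cmap X Q).

Definition quot_map : Prop :=
  (forall k (d : Q k), exists c, q k c = d) /\
  (forall k (c d : X k), q k c = q k d <-> ceqv m c d).

Hypothesis qm : quot_map.

Lemma quot0 x y : q 0 x = q 0 y <-> csim m x y.
Proof.
rewrite qm.2; split=> [/(_ (ones 0))|xy v]; first by rewrite !vert0.
by rewrite !vert0.
Qed.

Lemma quot_concrete : cconcrete Q.
Proof.
move=> k c d /(congr1 (fun u => u _)) cd; move: cd.
have [{}c <-] := qm.1 k c; have [{}d <-] := qm.1 k d => cd.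
by apply/qm.2 => v; apply/quot0; have := cd v; rewrite !vert_map.
Qed.

(** Arbitrary lifts of the vertices are equivalent, on each lower face, to a lift of that face;
    [lift_cubes] corrects them to a corner of [X]. *)
Lemma horn_lift k (H : cmap (corner k) Q) : 0 < k ->
  exists H' : cmap (corner k) X, cmap_comp q H' = H.
Proof.
move=> k0; have [hQ hQE] := corner_vals H k0.
have /choice[h hE] v := qm.1 0 (hQ v).
have [||//|g gP] := @lift_cubes nil_of (sim m) (@fill_sim nil_of m) k
  (fun w => w != ones k) h.
- move=> v w w1 wv; apply: contraNneq w1 => v1; move: wv.
  by rewrite v1 meetC meet1 => ->.
- move=> w w1; have [c cE] := qm.1 k (H k (exist _ _ (meet_corner w1))).
  exists (vert c); first exact: iscube_vert.
  move=> v wv; have hc : csim m (h v) (vert c v).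
    by apply/quot0; rewrite hE -vert_map cE hQE /= wv.
  by split=> //; exact: sim_sym.
- exact: sim_trans.
have [|H' H'E] := @corner_map X k g cX; first by move=> v /gP[].
exists H'; apply: cmap_ext => p f; apply: (vert_inj quot_concrete) => v.
rewrite hQE -hE /= vert_map H'E; apply/quot0.
by have [] := gP _ (corner_neq f v).
Qed.

Lemma quot_fibrant : cfibrant Q.
Proof.
move=> k k0 H; have [H' <-] := horn_lift H k0; have [x <-] := fX k0 H'.
by exists (q k x); apply: cmap_ext => p f /=; rewrite cmap_pull.
Qed.

(** A lift of [y] is equivalent to [H] on the corner, and [fill_sim] fills [H] equivalently to that
    lift. *)
Lemma quot_fill k (H : cmap (corner k) X) (y : Q k) : 0 < k ->
  cmap_comp q H = corner_restr y -> exists x, corner_restr x = H /\ q k x = y.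
Proof.
move=> k0 Hy; have [c cy] := qm.1 k y; have [h hE] := corner_vals H k0.
have hc (v : cube k) : v != ones k -> csim m (h v) (vert c v).
  move=> v1; apply/quot0; rewrite -vert_map cy.
  have := congr1 (fun u : cmap (corner k) _ => u 0 (exist _ _ (vertex_corner v1))) Hy.
  rewrite /= -/(vert y v) => <-; congr (q 0 _).
  by rewrite -[RHS](vert0 _ (ones 0)) hE.
have [v v1|z [x xE] zc] := @fill_sim nil_of m k h (vert c) (iscube_vert c) hc.
  exists (H k (exist _ _ (meet_corner v1))).
  by apply: funext => u; rewrite hE.
exists x; split.
  apply: cmap_ext => p f; apply: (vert_inj cX) => v /=.
  by rewrite vert_pull xE hE /upd ifN// corner_neq.
rewrite -cy; apply/qm.2 => v; rewrite xE /upd; case: eqVneq => [->//|].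
exact: hc.
Qed.

End Quot.

Lemma quot_step (Q : cubeset) n (q : cmap X Q) : quot_map n.+1 q -> n_step n Q.
Proof.
move=> qm; apply: n_stepP => k.
  move=> c d nk; have [{}c <-] := qm.1 k c; have [{}d <-] := qm.1 k d => cd.
  apply/qm.2 => v.
  have h (u : cube k) : u != ones k -> csim n.+1 (vert c u) (vert d u).
    move=> u1; apply/(quot0 qm); rewrite -!vert_map.
    exact: (cd _ (exist _ _ (vertex_corner u1))).
  have [->|] := eqVneq v (ones k); last exact: h.
  apply: (@sim_uniq nil_of k _ (vert c) (vert d)); rewrite ?wt_ones//.
  - exact: iscube_pull (iscube_vert c).
  - exact: iscube_pull (iscube_vert d).
  - by move=> u u1 _; exact: h.
move=> H nk; have [x <-] := quot_fibrant qm (leq_ltn_trans (leq0n n) nk) H.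
by exists x.
Qed.

(** * Maps to n-step cubesets identify ~_n-equivalent cubes *)

Section Invariance.
Variables (n : nat) (Y : cubeset) (nY : n_step n Y) (f : cmap X Y).

(** After a reflection the exceptional vertex is the last one; both images then restrict to the same
    corner of [Y]. *)
Lemma map_sim1 (c d : X n.+1) w : (forall v, v != w -> vert c v = vert d v) ->
  f _ c = f _ d.
Proof.
move=> cd; pose r : boxHom n.+1 n.+1 := bsel (fun j => inl (j, ~~ w j)).
have rK x : r (r x) = x by apply/ffunP => j; rewrite !ffunE /= addKb.
have r1 : r (ones _) = w by apply/ffunP => j; rewrite !ffunE /= addbT negbK.
have fr : f _ (pull r c) = f _ (pull r d).
  apply: (n_step_inj nY (ltnSn n)) => p g; rewrite -!cmap_pull; congr (f _ _).
  apply: (vert_inj cX) => v; rewrite !vert_pull; apply: cd.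
  by apply: contraNneq (corner_neq g v) => gw; rewrite -[sval g v]rK gw -r1 rK.
have rr e : pull r (pull r e) = e :> X n.+1.
  by apply: (vert_inj cX) => v; rewrite !vert_pull rK.
by rewrite -[c]rr -[d]rr cmap_pull fr -cmap_pull.
Qed.

Lemma map_sim_top (c d : X n.+1) : ceqv n.+1 c d -> f _ c = f _ d.
Proof.
move=> cd.
have key (s : seq (cube n.+1)) : exists e : X n.+1,
    f _ e = f _ c /\ forall x, vert e x = if x \in s then vert d x else vert c x.
  elim: s => [|v s [e [ec eE]]]; first by exists c.
  have : iscube (n := nil_of) (fun x => if x \in v :: s then vert d x else vert c x).
    apply: (iscube_sim (m := n.+1) (leqnn _) (iscube_vert c)) => x.
    by case: ifP => _; [exact: cd|exact: sim_refl].
  move=> [e' e'E]; exists e'; split=> [|x]; last by rewrite e'E.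
  rewrite -ec; apply: (@map_sim1 _ _ v) => x xv.
  by rewrite e'E eE inE (negbTE xv).
have [e [<- eE]] := key (enum {: cube n.+1}); congr (f _ _).
by apply: (vert_inj cX) => x; rewrite eE mem_enum.
Qed.

(** Up to dimension n+1 a cube is a retract of the (n+1)-cube; above, cubes of [Y] are determined by
    their facets. *)
Lemma map_sim k (c d : X k) : ceqv n.+1 c d -> f _ c = f _ d.
Proof.
have [kn|] := leqP k n.+1.
  pose a : boxHom n.+1 k := bsel (fun j => inl (widen_ord kn j, false)).
  pose b : boxHom k n.+1 :=
    bsel (fun j => if insub (val j) is Some i then inl (i, false) else inr false).
  have ab u : a (b u) = u.
    apply/ffunP => j; rewrite !ffunE /= (insubT (fun i => i < k) (ltn_ord j)) /=.
    by congr (u _); exact: val_inj.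
  move=> cd; have : f _ (pull a c) = f _ (pull a d).
    by apply: map_sim_top => v; rewrite !vert_pull.
  have ba e : pull b (pull a e) = e :> X k.
    by apply: (vert_inj cX) => v; rewrite !vert_pull ab.
  by move=> /(congr1 (pull b)); rewrite -!cmap_pull !ba.
elim: k c d => // k IH c d nk cd; apply: (n_step_inj nY); first exact: ltnW.
move=> p [e [i [g ge]]] /=; rewrite {e}ge !pull_comp -!(cmap_pull _ (eps i)); congr pull.
have epsE : ceqv n.+1 (pull (eps i) c) (pull (eps i) d).
  by move=> v; rewrite !vert_pull.
move: nk; rewrite ltnS leq_eqVlt => /orP[/eqP nk|nk]; last exact: IH.
by subst k; exact: map_sim_top.
Qed.

End Invariance.

End NilOf.

(** * Quotient of a cubeset by a congruence *)

Section CubesetQuot.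
Variables (X : cubeset) (R : forall k, X k -> X k -> Prop).
Hypothesis Rxx : forall k (c : X k), R c c.
Hypothesis Rsym : forall k (c d : X k), R c d -> R d c.
Hypothesis Rtrans : forall k (c d e : X k), R c d -> R d e -> R c e.
Hypothesis Rpull : forall m k (f : boxHom m k) (c d : X k), R c d -> R (pull f c) (pull f d).

Definition qcubes k : Type := {S : set (X k) | exists c, S = [set d | R c d]}.

Definition qclass k (c : X k) : qcubes k := exist _ [set d | R c d] (ex_intro _ c erefl).

Definition qrepr k (S : qcubes k) : X k := sval (cid (svalP S)).

Lemma qreprK k (S : qcubes k) : qclass (qrepr S) = S.
Proof. by apply: sig_ext => /=; rewrite /qrepr; case: cid. Qed.

Lemma qclassP k (c d : X k) : qclass c = qclass d <-> R c d.
Proof.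
split=> [/(congr1 sval)/= cd|cd].
  have : [set e | R d e] d by exact: Rxx.
  by rewrite -cd.
apply: sig_ext; apply/seteqP; split=> e /=; apply: Rtrans => //.
exact: Rsym.
Qed.

Lemma qrepr_class k (c : X k) : R (qrepr (qclass c)) c.
Proof. by apply/qclassP; rewrite qreprK. Qed.

Definition qpull m k (f : boxHom m k) (S : qcubes k) : qcubes m :=
  qclass (pull f (qrepr S)).

Lemma qpullE m k (f : boxHom m k) (c : X k) : qpull f (qclass c) = qclass (pull f c).
Proof. by apply/qclassP/Rpull; exact: qrepr_class. Qed.

Program Definition qcubeset : cubeset := @Cubeset qcubes qpull _ _.
Next Obligation. by move=> k S; rewrite /qpull pull_id qreprK. Qed.
Next Obligation. by move=> m k p g f S; rewrite -[S]qreprK !qpullE pull_comp. Qed.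

Program Definition qmap : cmap X qcubeset := @Cmap X qcubeset qclass _.
Next Obligation. by move=> m k f c; rewrite -[RHS]/(qpull _ _) qpullE. Qed.

End CubesetQuot.

(* The quotient by vertexwise ~_n is n-step and every map to an n-step cubeset
   factors through it, so that it satisfies the universal property of tau_n. *)
Lemma tau_quot (X : cubeset) (cX : cconcrete X) (fX : cfibrant X) n :
  quot_map cX fX n.+1 (tau_cunit n X).
Proof.
pose R k (c d : X k) := ceqv cX fX n.+1 c d.
have Rxx k (c : X k) : R k c c by move=> v; exact: sim_refl.
have Rsym k (c d : X k) : R k c d -> R k d c.
  by move=> cd v; apply: sim_sym; exact: cd.
have Rtrans k (c d e : X k) : R k c d -> R k d e -> R k c e.
  by move=> cd de v; apply: sim_trans (cd v) (de v).
have Rpull m k (f : boxHom m k) (c d : X k) : R k c d -> R m (pull f c) (pull f d).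
  by move=> cd v; rewrite !vert_pull.
pose q := qmap Rxx Rsym Rtrans Rpull.
have qm : quot_map cX fX n.+1 q.
  split=> [k d|k c d]; last exact: qclassP.
  by exists (qrepr d); exact: qreprK.
have nt := @tau_n_step n X.
(* Representatives need not be compatible with restriction, but their images in tau_n are, by
   [map_sim]. *)
have sP m k (f : boxHom m k) (S : qcubes R k) :
    tau_cunit n X m (qrepr (qpull f S)) = pull f (tau_cunit n X k (qrepr S)).
  rewrite -cmap_pull; apply: (@map_sim _ cX fX n _ nt).
  by apply: (qrepr_class Rxx Rsym Rtrans).
pose s : cmap (qcubeset Rxx Rsym Rtrans Rpull) (tau_cubeset n X) :=
  @Cmap (qcubeset Rxx Rsym Rtrans Rpull) (tau_cubeset n X)
    (fun k S => tau_cunit n X k (qrepr S)) sP.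
have sq : cmap_comp s q = tau_cunit n X.
  apply: cmap_ext => k c; rewrite -[LHS]/(tau_cunit n X k (qrepr (q k c))).
  apply: (@map_sim _ cX fX n _ nt).
  by apply: (qrepr_class Rxx Rsym Rtrans).
pose u := tau_desc (quot_step qm) q.
have uE k c : u k (tau_cunit n X k c) = q k c.
  exact: (congr1 (fun w : cmap _ _ => w k c) (tau_desc_unit (quot_step qm) q)).
(* By the universal property [s] inverts [u] on the left, so every cube of tau_n is the image of a
   representative. *)
have su : cmap_comp s u = cmap_id _.
  apply: (tau_uniq nt); apply: cmap_ext => k c.
  by rewrite -[LHS]/(s k (u k _)) uE -[LHS]/(cmap_comp s q k c) sq.
split=> [k d|k c d].
  exists (qrepr (u k d)).
  by rewrite -[LHS]/(cmap_comp s u k d) su.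
split=> [cd|]; last exact: (@map_sim _ cX fX n _ nt).
by apply/qm.2; rewrite -!uE cd.
Qed.

(** * The action of D_n(pi_n) *)

Lemma vert_const (Y : cubeset) (y : Y 0) k v : vert (const_cube y k) v = y.
Proof. by rewrite /vert pull_const /const_cube (box_term_uniq (box_term 0) (box_id 0)) pull_id. Qed.

Lemma eps_dropE k (i : 'I_k) (u : cube k) : u i = false -> eps i (box_drop i u) = u.
Proof.
move=> ui; apply/ffunP => j; rewrite ffunE; case: unliftP => [l ->|->//].
by rewrite ffunE.
Qed.

Lemma vert_face (Y : cubeset) k (d : Y k) (i : 'I_k) (u : cube k) : u i = false ->
  vert d u = vert (pull (eps i) d) (box_drop i u).
Proof. by move=> ui; rewrite vert_pull eps_dropE. Qed.

Section PiAct.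
Variables (n : nat) (Y : cubeset) (nY : n_step n.+1 Y).
Variables (cY : cconcrete Y) (fY : cfibrant Y).
Hypothesis erg : forall x y : nil_of cY fY, sim 1 x y.
Variable y0 : Y 0.

Let T := nil_of cY fY.
Let A := pi_cubes y0 n.+1.
Let mul : A -> A -> A := pi_mul nY (y0 := y0).
Let i1 : 'I_n.+2 := lift ord0 ord0.

Lemma n_step_sim (x y : T) : sim n.+2 x y -> x = y.
Proof.
move=> [c cE]; have ce : c = const_cube x n.+2.
  apply: (n_step_inj nY (ltnSn _)) => m f; apply: (vert_inj cY) => v.
  by rewrite !vert_pull vert0 cE /upd ifN// corner_neq.
by have := congr1 (@^~ (ones n.+2)) cE; rewrite ce vert_const /upd eqxx.
Qed.

(** Off its last vertex a cube of pi_(n+1) is [y0]; its last vertex identifies the group with the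
    ~_n-class of [y0]. *)
Definition pval (a : A) : T := vert (sval a) (ones n.+1).

Lemma vert_pi a : vert (sval a) = upd (fun=> y0) (ones n.+1) (pval a) :> (_ -> Y 0).
Proof.
apply: funext => v; rewrite /upd; case: eqVneq => [->//|v1].
have := svalP a _ (exist _ _ (vertex_corner v1)).
by rewrite /= -/(vert _ v) => ->; rewrite -[RHS](vert_const y0 (ones 0)) vert0.
Qed.

Lemma pval_inj : injective pval.
Proof.
move=> a b ab; apply: sig_ext; apply: (vert_inj cY) => v.
by rewrite !vert_pi ab.
Qed.

Lemma pval_sim a : sim n.+1 (y0 : T) (pval a).
Proof. by exists (sval a); exact: vert_pi. Qed.

Lemma pval_ex (t : T) : sim n.+1 (y0 : T) t -> exists a, pval a = t.
Proof.
move=> [c cE]; have cc : const_on_corner y0 c.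
  move=> m f; apply: (vert_inj cY) => v.
  by rewrite vert_pull vert_const cE /upd ifN// corner_neq.
by exists (exist _ c cc); rewrite /pval /= cE /upd eqxx.
Qed.

Lemma pval_one : pval (pi_one y0 n.+1) = y0.
Proof. exact: vert_const. Qed.

Lemma par_mul a b : par n.+1 (y0 : T) (pval a) (pval b) (pval (mul a b)).
Proof.
have [d [abd _]] := pi_mul_ex nY a b; have [d0 d1 d2] := abd.
have zE : pval (mul a b) = vert d (ones n.+2).
  rewrite /pval (pi_mulE nY abd) vert_pull; congr vert.
  by apply/ffunP => j; rewrite !ffunE; case: unlift => [?|]; rewrite ?ffunE.
have drop1 (v : cube n.+2) j : j != i1 -> v j = false -> box_drop i1 v != ones n.+1.
  rewrite eq_sym => ji vj; have [l jl _] := unlift_some ji.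
  by apply/eqP => /(congr1 (fun u : cube _ => u l)); rewrite !ffunE -jl vj.
(* The cube [b] spread along [i1]. It agrees with [d] off the upper edge in the first direction, and
   its own upper edge is (y0, [pval b]). *)
pose g (v : cube n.+2) : T := vert (sval b) (box_drop i1 v).
have gC : iscube g by exists (pull (box_drop i1) (sval b)); apply: funext => v; rewrite vert_pull.
have [h _] := iscube_repl (@nonfirst n.+1) (edge_fun (pval a) (pval (mul a b))) gC.
apply: (iscube_eq (h _)) => [|v].
  exists d; apply: funext => v; rewrite /repl nonfirstP.
  case: eqP => v1; rewrite /edge_fun; case v0 : (v ord0).
  - rewrite zE; congr vert; apply/ffunP => j; rewrite [RHS]ffunE.
    have [->//|] := eqVneq j ord0; rewrite eq_sym => ji; have [l -> _] := unlift_some ji.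
    by have := congr1 (fun u : cube _ => u l) v1; rewrite !ffunE.
  - by rewrite (vert_face d v0) d0 v1.
  - case vi : (v i1); last by rewrite (vert_face d vi) d1.
    have [j vj] : exists j, v j = false.
      have [l] := neq_ones (introN eqP v1).
      by rewrite ffunE; exists (lift ord0 l).
    have j1 : j != i1 by apply: contraFneq vj => ->.
    rewrite (vert_face d vj) d2 ?vert_const; last first.
      rewrite leqNgt; apply/negP => j2; have [e|e] : j = ord0 \/ j = i1.
        by case: (j) j2 => -[|[|//]] p _; [left|right]; exact: val_inj.
      + by rewrite e v0 in vj.
      + by rewrite e eqxx in j1.
    by rewrite /g vert_pi /upd ifN//; apply: drop1 vj.
  - rewrite (vert_face d v0) d0 vert_pi /upd ifN; last exact/eqP.
    by rewrite /g vert_pi /upd ifN//; apply: (drop1 _ ord0).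
rewrite /repl; case: ifP => //= _; rewrite /g vert_pi /upd /edge_fun.
case v0 : (v ord0); last first.
  by rewrite ifN//; apply: (drop1 _ ord0) => //; rewrite set_onesE v0.
rewrite ifT//; apply/eqP/ffunP => j; rewrite ffunE set_onesE ffunE.
by have [->|] := eqVneq (lift i1 j) ord0; rewrite ?v0 ?orbT// /nonfirst => ->.
Qed.

Definition pi_act (a : A) (y : T) : T :=
  sval (cid (par_ex erg y (pval_sim a))).

Lemma pi_actP a y : par n.+1 (y0 : T) (pval a) y (pi_act a y).
Proof. exact: svalP (cid (par_ex erg y (pval_sim a))). Qed.

Lemma pi_act_uniq a y z : par n.+1 (y0 : T) (pval a) y z -> pi_act a y = z.
Proof. exact: (par_uniq n_step_sim (pi_actP a y)). Qed.

Lemma pi_act_tr y z : sim n.+1 (y : T) z -> exists a, pi_act a y = z.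
Proof.
move=> yz; have [w yw] := par_ex erg (y0 : T) yz.
have /pval_ex[a aw] := par_sim (par_flip yw).
by exists a; apply: pi_act_uniq; rewrite aw; exact: par_flip.
Qed.

Lemma pi_act_free a b y : pi_act a y = pi_act b y -> a = b.
Proof.
move=> ab; apply: pval_inj.
apply: (par_uniq n_step_sim (par_flip (pi_actP a y))).
by rewrite ab; exact: par_flip (pi_actP b y).
Qed.

Lemma pval_mul a b : pval (mul a b) = pi_act a (pval b).
Proof. exact/esym/pi_act_uniq/par_mul. Qed.

Lemma pi_act_one y : pi_act (pi_one y0 n.+1) y = y.
Proof. by apply: pi_act_uniq; rewrite pval_one; exact: par_refl. Qed.

(** Stack (y0, b) parallel to (y, b.y) and (b, ab) parallel to (b.y, a.(b.y)); in the latter both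
    pairs are parallel to (y0, a). *)
Lemma pi_act_mul a b y : pi_act (mul a b) y = pi_act a (pi_act b y).
Proof.
apply: pi_act_uniq; apply: par_vtrans (pi_actP b y) _.
exact: par_htrans (par_flip (par_mul a b)) (pi_actP a _).
Qed.

(** Exchanging the first two coordinates of [d] swaps the faces [a] and [b] and preserves the
    diagonal [dup]. *)
Lemma pi_mulC a b : mul a b = mul b a.
Proof.
have [d [abd _]] := pi_mul_ex nY a b; have [d0 d1 d2] := abd.
pose s : boxHom n.+2 n.+2 := bsel (fun j => inl (tperm ord0 i1 j, false)).
have sE u j : s u j = u (tperm ord0 i1 j) by rewrite ffunE.
have tl (j : 'I_n.+1) : tperm ord0 i1 (lift i1 j) = lift ord0 j.
  have [->|j0] := eqVneq j ord0.
    by rewrite (_ : lift _ _ = ord0) ?tpermL//; exact: val_inj.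
  have e : lift i1 j = lift ord0 j.
    by apply: val_inj; rewrite /= /bump /=; move: j0; case: (j) => -[].
  by rewrite e tpermD // /i1 (inj_eq lift_inj) eq_sym.
have tl' (j : 'I_n.+1) : tperm ord0 i1 (lift ord0 j) = lift i1 j by rewrite -tl tpermK.
apply: sig_ext; rewrite (pi_mulE nY abd) (@pi_mulE _ _ nY _ _ _ (pull s d)).
  rewrite -pull_comp; congr pull; apply: boxHom_ext => x; apply/ffunP => j.
  rewrite -[RHS]/(s (dup n x) j) sE !ffunE.
  have [->|j0] := eqVneq j ord0.
    by rewrite tpermL liftK unlift_none.
  have [->|j1] := eqVneq j i1; first by rewrite tpermR liftK unlift_none.
  by rewrite tpermD // eq_sym.
split.
- apply: (vert_inj cY) => x; rewrite !vert_pull (@vert_face _ _ _ i1).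
    rewrite d1; congr vert; apply/ffunP => j.
    by rewrite ffunE sE tl ffunE liftK.
  by rewrite sE tpermR eps_at.
- apply: (vert_inj cY) => x; rewrite !vert_pull (@vert_face _ _ _ ord0).
    rewrite d0; congr vert; apply/ffunP => j.
    by rewrite ffunE sE tl' ffunE liftK.
  by rewrite sE tpermL eps_at.
move=> i i2; apply: (vert_inj cY) => x; rewrite vert_const !vert_pull (@vert_face _ _ _ i).
  by rewrite d2// vert_const.
rewrite sE tpermD ?eps_at//; first by apply: contraTneq i2 => <-.
by apply: contraTneq i2 => <-.
Qed.

(** Through the injection [pval], associativity and the unit law become properties of the action;
    translating [pval a] back to [y0] gives the inverse. *)
Lemma pi_abelian_law : abelian_group_law mul (pi_one y0 n.+1).
Proof.
split=> [a b c|a b|a|a].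
- by apply: pval_inj; rewrite !pval_mul !pi_act_mul.
- exact: pi_mulC.
- by apply: pval_inj; rewrite pval_mul pi_act_one.
have [b bE] := pi_act_tr (sim_sym (pval_sim a)).
by exists b; apply: pval_inj; rewrite pval_mul pval_one.
Qed.

End PiAct.

Section PiActMap.
Variables (n : nat) (Y Z : cubeset) (nZ : n_step n.+1 Z).
Variables (cY : cconcrete Y) (fY : cfibrant Y) (cZ : cconcrete Z) (fZ : cfibrant Z).
Hypothesis ergY : forall x y : nil_of cY fY, sim 1 x y.
Hypothesis ergZ : forall x y : nil_of cZ fZ, sim 1 x y.
Variables (y0 : Y 0) (z0 : Z 0) (f : cmap Y Z) (fy0 : f 0 y0 = z0).

Lemma iscube_map k (g : cube k -> Y 0) :
  iscube (n := nil_of cY fY) g -> iscube (n := nil_of cZ fZ) (fun x => f 0 (g x)).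
Proof. by move=> [c <-]; exists (f k c); apply: funext => v; rewrite vert_map. Qed.

Lemma pi_act_map a y :
  f 0 (pi_act ergY (y0 := y0) a y) =
  pi_act ergZ (y0 := z0) (pi_map (n := n) fy0 a) (f 0 y).
Proof.
apply/esym/(pi_act_uniq nZ).
apply: (iscube_eq (iscube_map (pi_actP ergY a y))) => v.
rewrite /repl /edge_fun /pval /= vert_map -fy0.
by case: ifP; case: (v ord0).
Qed.

End PiActMap.

Section DAct.
Variables (n : nat) (Y : cubeset) (nY : n_step n.+1 Y).
Variables (cY : cconcrete Y) (fY : cfibrant Y).
Hypothesis erg : forall x y : nil_of cY fY, sim 1 x y.
Variables (y0 : Y 0) (H : abelian_group_law (pi_mul nY (y0 := y0)) (pi_one y0 n.+1)).

Let A := zmod_of H.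
Let act : A -> nil_of cY fY -> nil_of cY fY := pi_act erg (y0 := y0).
Let val : A -> nil_of cY fY := @pval n Y cY fY y0.

Let act0 y : act 0%R y = y. Proof. exact: (pi_act_one nY). Qed.
Let actD a b y : act (a + b)%R y = act a (act b y). Proof. exact: (pi_act_mul nY). Qed.
Let actP a y : par n.+1 (val 0%R) (val a) y (act a y).
Proof.
have -> : val 0%R = y0 by exact: (pval_one n cY fY y0).
exact: pi_actP.
Qed.

Lemma Dact_ex k (f : D_cubeset n.+1 A k) (c : Y k) :
  exists d : Y k, vert d = fun x => act (sval f x) (vert c x).
Proof.
exact: (D_act_cube (@n_step_sim n Y nY cY fY) act0 actD actP (svalP f) (iscube_vert cY fY c)).
Qed.

Definition Dact k (f : D_cubeset n.+1 A k) (c : Y k) : Y k := sval (cid (Dact_ex f c)).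

Lemma vert_Dact k (f : D_cubeset n.+1 A k) (c : Y k) x :
  vert (Dact f c) x = pi_act erg (y0 := y0) (sval f x) (vert c x).
Proof. by rewrite /Dact; case: cid => d /= ->. Qed.

Lemma Dact_free k (f g : D_cubeset n.+1 A k) (c : Y k) : Dact f c = Dact g c -> f = g.
Proof.
move=> fg; apply: sig_ext; apply/ffunP => x; apply: (pi_act_free nY (erg := erg) (y := vert c x)).
by rewrite -!vert_Dact fg.
Qed.

Lemma Dact_sim k (f : D_cubeset n.+1 A k) (c : Y k) : ceqv cY fY n.+1 c (Dact f c).
Proof.
by move=> x; rewrite vert_Dact; exact: par_sim (par_flip (pi_actP erg (sval f x) (vert c x))).
Qed.

Lemma Dact_tr k (c d : Y k) : ceqv cY fY n.+1 c d ->
  exists f : D_cubeset n.+1 A k, Dact f c = d.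
Proof.
move=> cd; have [f fD fE] := D_act_tr (@n_step_sim n Y nY cY fY) act0 actD actP
  (@pi_act_tr n Y nY cY fY erg y0) (iscube_vert cY fY c) (iscube_vert cY fY d) cd.
exists (exist _ f fD); apply: (vert_inj cY) => x.
by rewrite vert_Dact -fE.
Qed.

End DAct.

(** * The tower of a condensed cubeset *)

Section QuotTower.
Variables (X Y Z : cubeset) (cX : cconcrete X) (fX : cfibrant X).
Variables (cY : cconcrete Y) (fY : cfibrant Y).

(** For the converse, lift the witnessing cube; its vertices are right up to [sim m], and a k-cube
    with k <= m allows such replacements. *)
Lemma sim_quot k m (q : cmap X Y) x y : quot_map cX fX m q -> k <= m ->
  csim cX fX k x y <-> csim cY fY k (q 0 x) (q 0 y).
Proof.
move=> qm km; split=> [xy|[c' cE]].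
  apply: (iscube_eq (@iscube_map X Y cX fX cY fY q _ _ xy)) => v.
  by rewrite /upd; case: ifP.
have [c cc] := qm.1 k c'; apply: (iscube_sim km (iscube_vert cX fX c)) => v.
apply/(quot0 qm); rewrite -vert_map cc cE /upd.
by case: ifP.
Qed.

Lemma quot_tower k m (q : cmap X Y) (r : cmap X Z) (p : cmap Y Z) :
  quot_map cX fX m q -> quot_map cX fX k r -> k <= m ->
  (forall l (c : X l), p l (q l c) = r l c) -> quot_map cY fY k p.
Proof.
move=> qm rm km pq; split=> [l d|l c d].
  by have [c <-] := rm.1 l d; exists (q l c).
have [{}c <-] := qm.1 l c; have [{}d <-] := qm.1 l d; rewrite !pq rm.2.
split=> cd v; first by rewrite !vert_map -(sim_quot _ _ qm km).
by have := cd v; rewrite !vert_map -(sim_quot _ _ qm km).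
Qed.

End QuotTower.

Section Psh.
Variable kappa : strong_limit.
Implicit Types X Y Z : cubePsh kappa.

Lemma bij_is_iso X Y (f : pshMap X Y) :
  (forall E k, injective (f E k)) -> surjective f -> is_iso f.
Proof.
move=> fI fS; pose g E k (y : Y E k) : X E k := sval (cid (fS E k y)).
have fg E k y : f E k (g E k y) = y by rewrite /g; case: cid.
have gp E m k (h : boxHom m k) y : g E m (pull h y) = pull h (g E k y).
  by apply: fI; rewrite cmap_pull !fg.
have gr (E E' : extr kappa) (h : continuousType E' E) k (y : Y E k) :
    g E' k (psh_res Y h k y) = psh_res X h k (g E k y).
  by apply: fI; rewrite map_res !fg.
exists (@PshMap _ Y X (fun E => @Cmap (Y E) (X E) (@g E) (@gp E)) gr).
split; apply: pshMap_ext => E k c /=; last exact: fg.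
by apply: fI; rewrite fg.
Qed.

Lemma is_iso_inj X Y (f : pshMap X Y) : is_iso f -> forall E k, injective (f E k).
Proof.
move=> [g [gf _]] E k x y fxy.
have h z : g E k (f E k z) = z by exact: (congr1 (fun w : pshMap X X => w E k z) gf).
by rewrite -[x]h fxy h.
Qed.

Lemma surj_factor X Y Z (p : pshMap X Y) (q : pshMap X Z) : surjective p ->
  (forall E k (c d : X E k), p E k c = p E k d -> q E k c = q E k d) ->
  exists! r : pshMap Y Z, psh_comp r p = q.
Proof.
move=> pS pq; pose s E k (y : Y E k) : X E k := sval (cid (pS E k y)).
have ps E k y : p E k (s E k y) = y by rewrite /s; case: cid.
have gp E m k (h : boxHom m k) y :
    q E m (s E m (pull h y)) = pull h (q E k (s E k y)).
  by rewrite -cmap_pull; apply: pq; rewrite cmap_pull !ps.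
have gr (E E' : extr kappa) (h : continuousType E' E) k (y : Y E k) :
    q E' k (s E' k (psh_res Y h k y)) = psh_res Z h k (q E k (s E k y)).
  by rewrite -map_res; apply: pq; rewrite map_res !ps.
exists (@PshMap _ Y Z (fun E => @Cmap (Y E) (Z E) (fun k y => q E k (s E k y)) (@gp E)) gr).
split; first by apply: pshMap_ext => E k c /=; apply: pq; rewrite ps.
move=> r rp; apply: pshMap_ext => E k y /=.
by rewrite -rp /= ps.
Qed.

(** * Preservation of finite products by D_d(A) *)

Section CondensedD.
Variables (d : nat) (A : abPsh kappa).
Local Open Scope ring_scope.

(** Extension by zero, checked on generators. A pair of cubes over the two summands is then glued as
    the sum of its two extensions. *)
Lemma D_extend (E1 E2 E : extr kappa) (i1 : continuousType E1 E) (i2 : continuousType E2 E) :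
  (forall a1 : A E1, exists a : A E, ab_res A i1 a = a1 /\ ab_res A i2 a = 0) ->
  forall n (f1 : {ffun cube n -> A E1}), D_sub d f1 ->
    exists2 f : {ffun cube n -> A E}, D_sub d f &
      forall x : cube n, ab_res A i1 (f x) = f1 x /\ ab_res A i2 (f x) = 0.
Proof.
move=> Aex n; have [D0 DB] := D_sub_subgroup d (A E) n.
apply: D_sub_ind => [|_ [a1 [p [pd ->]]]].
  split=> [|f1 g1 [f fD fE] [g gD gE]].
    by exists 0 => // x; rewrite !ffunE !raddf0.
  exists (f - g); first exact: DB.
  move=> x; rewrite !ffunE !raddfB; have [-> ->] := fE x; have [-> ->] := gE x.
  by rewrite subr0.
have [a [a1E a2E]] := Aex a1.
exists [ffun x => if face p x then a else 0]; first by apply: D_sub_gen; exists a, p.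
by move=> x; rewrite !ffunE; case: ifP; rewrite ?raddf0.
Qed.

Hypothesis A_initial : forall E, is_initial E -> forall a : A E, a = 0.
Hypothesis A_coprod : forall (E1 E2 E : extr kappa) (i1 : continuousType E1 E)
  (i2 : continuousType E2 E), is_coproduct i1 i2 -> forall (a1 : A E1) (a2 : A E2),
    exists! a : A E, ab_res A i1 a = a1 /\ ab_res A i2 a = a2.

Lemma D_psh_condensed : condensed (D_psh d A).
Proof.
split=> [E /A_initial A0 k|E1 E2 E i1 i2 /A_coprod AE k [f1 f1D] [f2 f2D]].
  exists (exist _ 0 (@D_sub0 _ d A E k)); split=> // -[f fD] _; apply: sig_ext.
  by apply/ffunP => x; rewrite ffunE [RHS]A0.
have [|f fD fE] := D_extend (i1 := i1) (i2 := i2) _ f1D.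
  by move=> a1; have [a [aE _]] := AE a1 0; exists a.
have [|g gD gE] := D_extend (i1 := i2) (i2 := i1) _ f2D.
  by move=> a2; have [a [[? ?] _]] := AE 0 a2; exists a.
exists (exist _ (f + g) (D_subD fD gD)); split.
  split; apply: sig_ext; apply/ffunP => x; rewrite !ffunE raddfD;
    by rewrite ?(fE x).1 ?(fE x).2 ?(gE x).1 ?(gE x).2 ?addr0 ?add0r.
move=> [h hD] [h1 h2]; apply: sig_ext; apply/ffunP => x.
have := congr1 (fun u : D_psh d A E1 k => sval u x) h1.
have := congr1 (fun u : D_psh d A E2 k => sval u x) h2.
rewrite /= !ffunE => {}h2 {}h1.
have [a [_ aU]] := AE (f1 x) (f2 x); transitivity a; last exact: aU.
apply/esym/aU; rewrite !raddfD.
by rewrite (fE x).1 (fE x).2 (gE x).1 (gE x).2 addr0 add0r.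
Qed.

End CondensedD.

Section Tower.
Variable X : cubePsh kappa.
Hypotheses (condX : condensed X) (concX : concrete X) (fibX : fibrant X).

Lemma concrete_at E : cconcrete (X E).
Proof. exact: concX. Qed.

Lemma fibrant_at E : cfibrant (X E).
Proof.
move=> k k0 h.
have e : cmap_comp (to_pt X E) h = @corner_restr (psh_pt kappa E) k tt by exact: cmap_ext.
by have [x [xh _]] := fibX k0 e; exists x.
Qed.

Let cX := concrete_at.
Let fX := fibrant_at.

Lemma unit_quot n E : quot_map (@cX E) (@fX E) n.+1 (tau_unit n X E).
Proof. exact: tau_quot. Qed.

Lemma tau_concrete n : concrete (tau n X).
Proof. by move=> E; exact: quot_concrete (unit_quot n E). Qed.

Lemma tau_cconcrete n E : cconcrete (tau n X E).
Proof. exact: tau_concrete. Qed.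

Lemma tau_cfibrant n E : cfibrant (tau n X E).
Proof. exact: quot_fibrant (unit_quot n E). Qed.

Lemma tau_fibrant n : fibrant (tau n X).
Proof.
move=> k k0 E h [] _; have [x xh] := tau_cfibrant k0 h.
by exists x.
Qed.

Lemma tau_proj_unit n : psh_comp (tau_proj n X) (tau_unit n.+1 X) = tau_unit n X.
Proof. exact: tau_lift_unit. Qed.

Lemma proj_quot n E : quot_map (@tau_cconcrete n.+1 E) (@tau_cfibrant n.+1 E) n.+1
  (tau_proj n X E).
Proof.
apply: quot_tower (unit_quot n.+1 E) (unit_quot n E) (leqnSn _) _ => l c.
exact: (congr1 (fun w : pshMap X (tau n X) => w E l c) (tau_proj_unit n)).
Qed.

Lemma tau_condensed n : condensed (tau n X).
Proof.
have [X0 X2] := condX; split=> [E iE k|E1 E2 E i1 i2 iE k c1 c2].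
  have [c [_ cU]] := X0 E iE k; exists (tau_unit n X E k c); split=> // d _.
  by have [d' <-] := (unit_quot n E).1 k d; rewrite (cU d').
have [{}c1 <-] := (unit_quot n E1).1 k c1; have [{}c2 <-] := (unit_quot n E2).1 k c2.
have [c [[cc1 cc2] _]] := X2 E1 E2 E i1 i2 iE k c1 c2.
exists (tau_unit n X E k c); split; first by rewrite -!map_res cc1 cc2.
move=> d; have [{}d <-] := (unit_quot n E).1 k d; rewrite -!map_res -cc1 -cc2.
move=> [/esym d1 /esym d2]; apply/(unit_quot n E).2 => v.
(* An equivalence of vertices is witnessed by one cube over each summand, and these two cubes glue
   over [E]. *)
have {d1}[e1 e1E] := ((unit_quot n E1).2 _ _ _).1 d1 v.
have {d2}[e2 e2E] := ((unit_quot n E2).2 _ _ _).1 d2 v.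
have [e [[ee1 ee2] _]] := X2 E1 E2 E i1 i2 iE n.+1 e1 e2.
exists e; apply: funext => u.
set w := upd _ _ _ u.
have [z [_ zU]] := X2 E1 E2 E i1 i2 iE 0 (psh_res X i1 0 w) (psh_res X i2 0 w).
transitivity z; last by apply: zU.
apply/esym/zU; rewrite -!vert_map ee1 ee2 e1E e2E /w /upd !vert_map.
by case: ifP.
Qed.

Hypothesis ergX : ergodic X.

(** The relation [sim 1] is the one divided out by tau_0, so ergodicity makes it total on [X]; it
    passes to the quotient. *)
Lemma tau_ergodic n E :
  forall x y : nil_of (@tau_cconcrete n E) (@tau_cfibrant n E), sim 1 x y.
Proof.
move=> x y; have [x' <-] := (unit_quot n E).1 0 x; have [y' <-] := (unit_quot n E).1 0 y.
have xy : csim (@cX E) (@fX E) 1 x' y'.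
  by apply/(quot0 (unit_quot 0 E)); exact: (is_iso_inj ergX).
exact: ((@sim_quot _ _ _ _ (@tau_cconcrete n E) (@tau_cfibrant n E) _ _ _ _ _
  (unit_quot n E) (ltn0Sn n)).1 xy).
Qed.

(** * The principal bundle structure of the tower *)

Section Bundle.
Variables (n : nat) (x0 : base_point X).

Lemma pi_abelian_tau : pi_abelian n x0.
Proof. by move=> E; exact: (pi_abelian_law _ (@tau_ergodic n.+1 E)). Qed.

Let H : pi_abelian n x0 := pi_abelian_tau.
Let A := pi_ab H.
Let G := calD n.+1 A.
Let Y := tau n.+1 X.

Lemma pi_condensed :
  (forall E, is_initial E -> forall a : A E, a = 0%R) /\
  (forall (E1 E2 E : extr kappa) (i1 : continuousType E1 E)
    (i2 : continuousType E2 E), is_coproduct i1 i2 -> forall (a1 : A E1) (a2 : A E2),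
    exists! a : A E, ab_res A i1 a = a1 /\ ab_res A i2 a = a2).
Proof.
have [Y0 Y2] := tau_condensed n.+1; split=> [E iE a|E1 E2 E i1 i2 iE a1 a2].
  apply: sig_ext; have [c [_ cU]] := Y0 E iE n.+1.
  by rewrite -[LHS]cU// -[RHS]cU.
have [c [[cc1 cc2] cU]] := Y2 E1 E2 E i1 i2 iE n.+1 (sval a1) (sval a2).
(* This holds over both summands, and gluing is unique. *)
have cc : const_on_corner (tau_base n x0 E) c.
  move=> m f; have [e [_ eU]] := Y2 E1 E2 E i1 i2 iE m
    (const_cube (tau_base n x0 E1) m) (const_cube (tau_base n x0 E2) m).
  transitivity e; last first.
    by apply: eU; rewrite (cmap_const (tau_base_res n x0 i1)) (cmap_const (tau_base_res n x0 i2)).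
  by apply/esym/eU; rewrite !cmap_pull cc1 cc2 (svalP a1) (svalP a2).
pose b0 : pi_cubes (tau_base n x0 E) n.+1 := exist _ c cc.
exists (b0 : A E); split; first by split; apply: sig_ext.
move=> b [b1 b2]; apply: sig_ext; apply: cU; split.
  exact: (congr1 (fun u : pi_cubes (tau_base n x0 E1) n.+1 => sval u) b1).
exact: (congr1 (fun u : pi_cubes (tau_base n x0 E2) n.+1 => sval u) b2).
Qed.

Lemma act_pull E m k (h : boxHom m k) (f : G E k) (c : Y E k) :
  Dact (H := H E) (@tau_ergodic n.+1 E) (pull h f) (pull h c) =
  pull h (Dact (H := H E) (@tau_ergodic n.+1 E) f c).
Proof.
apply: (vert_inj (@tau_cconcrete n.+1 E)) => v.
by rewrite vert_pull !vert_Dact vert_pull ffunE.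
Qed.

Lemma act_res (E E' : extr kappa) (h : continuousType E' E) k (f : G E k) (c : Y E k) :
  Dact (H := H E') (@tau_ergodic n.+1 E') (psh_res G h k f) (psh_res Y h k c) =
  psh_res Y h k (Dact (H := H E) (@tau_ergodic n.+1 E) f c).
Proof.
apply: (vert_inj (@tau_cconcrete n.+1 E')) => v.
rewrite vert_map !vert_Dact ffunE vert_map.
exact/esym/(pi_act_map (@tau_n_step n.+1 (X E')) (@tau_ergodic n.+1 E) (@tau_ergodic n.+1 E') (tau_base_res n x0 h)).
Qed.

Definition bundle_act : pshMap (psh_prod G Y) Y :=
  @PshMap _ (psh_prod G Y) Y
    (fun E => @Cmap (psh_prod G Y E) (Y E)
       (fun k c => Dact (H := H E) (@tau_ergodic n.+1 E) c.1 c.2)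
       (fun m k h c => act_pull h c.1 c.2))
    (fun E E' h k c => act_res h c.1 c.2).

Lemma bundle_act_over : psh_comp (tau_proj n X) bundle_act =
  psh_comp (tau_proj n X) (psh_snd G Y).
Proof.
apply: pshMap_ext => E k [f c] /=; apply/esym/(proj_quot n E).2.
exact: Dact_sim.
Qed.

Lemma tau_bundle : principal_bundle G (tau_proj n X).
Proof.
split.
  split; [|exact: tau_condensed|exact: tau_condensed].
  by have [A0 A2] := pi_condensed; exact: D_psh_condensed.
exists bundle_act, bundle_act_over; split.
- move=> E k x; apply: (vert_inj (@tau_cconcrete n.+1 E)) => v.
  rewrite vert_Dact /= ffunE; exact: (pi_act_one (@tau_n_step n.+1 (X E))).
- move=> E k a b x; apply: (vert_inj (@tau_cconcrete n.+1 E)) => v.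
  rewrite !vert_Dact /= ffunE.
  exact: (@pi_act_mul n _ (@tau_n_step n.+1 (X E)) _ _ (@tau_ergodic n.+1 E) _
    (sval a v) (sval b v)).
(* Injectivity is freeness of the action; surjectivity is transitivity on the fibres. *)
- apply: bij_is_iso => [E k [f c] [g d] fg|E k [[c d] /= cd]].
    have /= := congr1 (fun u : psh_pullback _ _ E k => (sval u).2) fg.
    have /= := congr1 (fun u : psh_pullback _ _ E k => (sval u).1) fg.
    by move=> + cd; rewrite {fg}cd => fg; congr pair; exact: (@Dact_free _ _ _ _ _ _ _ (H E) _ _ _ _ fg).
  have /((proj_quot n E).2 _ _ _).1 dc := esym cd.
  have [f fE] := Dact_tr (@tau_ergodic n.+1 E) (H E) dc.
  by exists (f, d); apply: sig_ext; rewrite /= fE.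
(* The fibres of the projection are the orbits, so an invariant map factors uniquely through this
   surjection. *)
split; first exact: bundle_act_over.
move=> Z q _ qE; apply: surj_factor => [E k y|E k c d]; first exact: (proj_quot n E).1.
move/(proj_quot n E).2 => cd.
have [f <-] := Dact_tr (@tau_ergodic n.+1 E) (H E) cd.
exact/esym/(congr1 (fun w : pshMap (psh_prod G Y) Z => w E k (f, c)) qE).
Qed.

End Bundle.
End Tower.

Lemma quot_fibration X Y (p : pshMap X Y) m (cX : forall E, cconcrete (X E))
    (fX : forall E, cfibrant (X E)) :
  (forall E, quot_map (cX E) (fX E) m (p E)) -> surjective p /\ fibration p.
Proof.
move=> pq; split=> [E k y|k k0 E h y hy]; first exact: (pq E).1.
exact: (quot_fill (pq E)).
Qed.

(** * Naturality of the tower *)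

Lemma tau_map_unit X Y (f : pshMap X Y) n :
  psh_comp (tau_map n f) (tau_unit n X) = psh_comp (tau_unit n Y) f.
Proof. exact: tau_lift_unit. Qed.

Lemma psh_compA W X Y Z (h : pshMap Y Z) (g : pshMap X Y) (f : pshMap W X) :
  psh_comp h (psh_comp g f) = psh_comp (psh_comp h g) f.
Proof. exact: pshMap_ext. Qed.

(** The target is n-step, hence (n+1)-step, so both sides may be compared after the unit of
    tau_(n+1). *)
Lemma tau_map_proj X Y (f : pshMap X Y) n :
  psh_comp (tau_map n f) (tau_proj n X) = psh_comp (tau_proj n Y) (tau_map n.+1 f).
Proof.
apply: (tau_lift_uniq (psh_n_step_le (leqnSn n) (@tau_psh_n_step _ n Y))).
by rewrite -!psh_compA tau_proj_unit !tau_map_unit psh_compA tau_proj_unit.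
Qed.

Lemma tau_map_id n X : tau_map n (psh_id X) = psh_id (tau n X).
Proof.
apply: (tau_lift_uniq (@tau_psh_n_step _ n X)); rewrite tau_map_unit.
exact: pshMap_ext.
Qed.

Lemma tau_map_comp n X Y Z (f : pshMap X Y) (g : pshMap Y Z) :
  tau_map n (psh_comp g f) = psh_comp (tau_map n g) (tau_map n f).
Proof.
apply: (tau_lift_uniq (@tau_psh_n_step _ n Z)).
by rewrite tau_map_unit -psh_compA tau_map_unit !psh_compA tau_map_unit.
Qed.

End Psh.

Theorem mainTheorem3 (kappa : strong_limit) :
  (forall X : cubePsh kappa,
    condensed X -> concrete X -> ergodic X -> fibrant X ->
    [/\ forall n : nat, surjective (tau_unit n X) /\ fibration (tau_unit n X),
        forall n : nat, surjective (tau_proj n X) /\ fibration (tau_proj n X),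
        forall n : nat, psh_comp (tau_proj n X) (tau_unit n.+1 X) = tau_unit n X,
        forall n : nat,
          [/\ condensed (tau n X), concrete (tau n X), fibrant (tau n X)
            & psh_n_step n (tau n X)]
      & forall (n : nat) (x0 : base_point X), exists H : pi_abelian n x0,
          principal_bundle (calD n.+1 (pi_ab H)) (tau_proj n X)]) /\
  (forall X Y : cubePsh kappa,
    condensed X -> concrete X -> ergodic X -> fibrant X ->
    condensed Y -> concrete Y -> ergodic Y -> fibrant Y ->
    forall (f : pshMap X Y) (n : nat),
      psh_comp (tau_map n f) (tau_unit n X) = psh_comp (tau_unit n Y) f /\
      psh_comp (tau_map n f) (tau_proj n X) =
        psh_comp (tau_proj n Y) (tau_map n.+1 f)) /\
  (forall X : cubePsh kappa,
    condensed X -> concrete X -> ergodic X -> fibrant X ->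
    forall n : nat, tau_map n (psh_id X) = psh_id (tau n X)) /\
  (forall X Y Z : cubePsh kappa,
    condensed X -> concrete X -> ergodic X -> fibrant X ->
    condensed Y -> concrete Y -> ergodic Y -> fibrant Y ->
    condensed Z -> concrete Z -> ergodic Z -> fibrant Z ->
    forall (f : pshMap X Y) (g : pshMap Y Z) (n : nat),
      tau_map n (psh_comp g f) = psh_comp (tau_map n g) (tau_map n f)).
Proof.
split=> [X condX concX ergX fibX|].
  split=> n.
  - exact: (quot_fibration (unit_quot concX fibX n)).
  - exact: (quot_fibration (proj_quot concX fibX n)).
  - exact: tau_proj_unit.
  - split; [exact: tau_condensed|exact: tau_concrete|exact: tau_fibrant|].
    exact: tau_psh_n_step.
  - move=> x0; exists (pi_abelian_tau concX fibX ergX n x0); exact: tau_bundle.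
split=> [X Y _ _ _ _ _ _ _ _ f n|]; first by split; [exact: tau_map_unit|exact: tau_map_proj].
split=> [X _ _ _ _ n|X Y Z _ _ _ _ _ _ _ _ _ _ _ _ f g n]; first exact: tau_map_id.
exact: tau_map_comp.
Qed.
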